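(* Let $C\subset(0,\infty)$ be a set condensating to $\infty$, and let $f:\mathbb{R}^2\to\mathbb{R}$ be a continuous function. Then $f$ is vertically rigid for $C$ if and only if, after a suitable rotation around the $z$-axis, $f(x,y)$ is of one of the following forms: (i) $a+bx+dy$ with $a,b,d\in\mathbb{R}$; (ii) $a+s(y)e^{kx}$ with $a,k\in\mathbb{R}$, $k\neq 0$, and $s:\mathbb{R}\to\mathbb{R}$ continuous; (iii) $a+be^{kx}+dy$ with $a,b,d,k\in\mathbb{R}$, $k\neq 0$.
   Context: A set $C\subset(0,\infty)$ condensates to $\infty$ if for every $r\in\mathbb{R}$ the set $C\cap(r,\infty)$ is uncountable. For $f:\mathbb{R}^2\to\mathbb{R}$ write $graph(f)=\{(x,y,f(x,y)):(x,y)\in\mathbb{R}^2\}\subset\mathbb{R}^3$. The function $f$ is vertically rigid for $C$ if for every $c\in C$ there is an isometry $\varphi$ of $\mathbb{R}^3$ (not necessarily orientation-preserving) with $\varphi(graph(f))=graph(cf)$. ''After a suitable rotation around the $z$-axis $f(x,y)$ is of a given form'' means that there is a rotation $\rho$ of $\mathbb{R}^2$ about the origin such that the function $f\circ\rho$ is of that form. *)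

(* Defs.v *)
From HB Require Import structures.
From mathcomp Require Import all_boot all_order all_algebra.
From mathcomp Require Import all_classical all_reals all_analysis.
Import Order.TTheory GRing.Theory Num.Theory.
Import numFieldNormedType.Exports.

Set Implicit Arguments.
Unset Strict Implicit.
Unset Printing Implicit Defensive.

Local Open Scope classical_set_scope.
Local Open Scope ring_scope.

Definition condensates_to_infty (R : realType) (C : set R) : Prop :=
  C `<=` [set c | 0 < c] /\
  forall r : R, ~ countable (C `&` [set c | r < c]).

(* The library's norm on a product type is the max norm, so the Euclidean
   distance is written out. *)
Definition dist3 (R : realType) (p q : R * R * R) : R :=
  Num.sqrt ((p.1.1 - q.1.1) ^+ 2 + (p.1.2 - q.1.2) ^+ 2 + (p.2 - q.2) ^+ 2).

Definition isometry3 (R : realType) (phi : R * R * R -> R * R * R) : Prop :=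
  bijective phi /\ forall p q, dist3 (phi p) (phi q) = dist3 p q.

Definition graph (R : realType) (f : R * R -> R) : set (R * R * R) :=
  range (fun p : R * R => (p, f p)).

Definition vertically_rigid (R : realType) (C : set R) (f : R * R -> R)
    : Prop :=
  forall c : R, C c -> exists phi : R * R * R -> R * R * R,
    isometry3 phi /\ phi @` graph f = graph (fun p => c * f p).

Definition rotation (R : realType) (t : R) (p : R * R) : R * R :=
  (cos t * p.1 - sin t * p.2, sin t * p.1 + cos t * p.2).

Definition form_affine (R : realType) (g : R * R -> R) : Prop :=
  exists a b d : R, forall x y : R, g (x, y) = a + b * x + d * y.

Definition form_product_exp (R : realType) (g : R * R -> R) : Prop :=
  exists (a k : R) (s : R -> R), k != 0 /\ continuous s /\
    forall x y : R, g (x, y) = a + s y * expR (k * x).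

Definition form_exp_plus_linear (R : realType) (g : R * R -> R) : Prop :=
  exists a b d k : R, k != 0 /\
    forall x y : R, g (x, y) = a + b * expR (k * x) + d * y.

(* Main.v *)
Require Import Defs.
From mathcomp Require Import all_boot all_order all_algebra.
From mathcomp Require Import all_classical all_reals all_analysis.
From mathcomp Require Import ring lra.
Import Order.TTheory GRing.Theory Num.Theory.
Import numFieldNormedType.Exports.
Local Open Scope classical_set_scope.
Local Open Scope ring_scope.
Set Implicit Arguments.
Unset Strict Implicit.
Unset Printing Implicit Defensive.

(* Call (v, z) a slope direction of f if f (p + t v) <= f p + t z for all p and
   all t >= 0; these directions form a closed convex cone Q_f containing e3. The
   directions for which the inequality is strict when t > 0 are, up to sign, those
   that no chord of the graph has, so if an isometry with linear part A maps graph(f) to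
   graph(c f), then A maps Q_f onto Q_(c f) or its opposite, and Q_(c f) is Q_f
   stretched vertically by c.

   If Q_f contains no line, then it lies in z >= 0, since for c large the
   stretched cone would contain almost opposite unit vectors. Hence Q_(c f) is
   contained in Q_f for c > 1, and as an isometry mapping Q_f into itself is onto
   (by recurrence), Q_f is V x [0, oo) for a planar cone V with at most two
   extreme rays. So A^-1 e3, which spans an extreme ray of Q_f up to sign, takes
   finitely many values as c varies, and for uncountably many c the value is the
   same; the graphs of these c f are then related by isometries fixing the
   vertical direction: c f (N p + b) = c0 f p + beta with N in O(2). Iterating
   once, N^2 is a rotation, and a fixed point would force f to be constant, so
   f (p + u) = (c0 / c)^2 f p + v. Uncountably many such translations accumulate
   at 0 and yield f (p + t w) - a = exp (k t) (f p - a), which is form (ii).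

   If Q_f contains a line, then f (x, y) = g x + d y after a rotation. A rotation
   about the x-axis removes d y at the price of replacing each c by
   c sqrt(1 + d^2) / sqrt(1 + c^2 d^2); Q_f becomes a planar cone, and comparing
   the angle between its two sides for three values of c shows that it is a
   vertical ray or a quadrant, unless g is affine. The same argument then gives
   form (iii). *)

(** * Isometries of three-space *)

Definition dot {R : realType} (p q : R * R * R) : R :=
  p.1.1 * q.1.1 + p.1.2 * q.1.2 + p.2 * q.2.

(** Orthogonal maps as plain functions; invertibility is carried separately by an explicit inverse
    [A']. *)
Definition orth {R : realType} (A : R * R * R -> R * R * R) : Prop :=
  (forall a u v, A (a *: u + v) = a *: A u + A v) /\
  (forall u v, dot (A u) (A v) = dot u v).

Lemma scaleRE {R : realType} (a x : R) : a *: x = a * x.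
Proof. by []. Qed.

Section Dot.
Context {R : realType}.
Implicit Types u v w p q : R * R * R.

Lemma dotC u v : dot u v = dot v u.
Proof. by rewrite /dot; ring. Qed.

Lemma dotP a u v w : dot (a *: u + v) w = a * dot u w + dot v w.
Proof. by rewrite /dot /= !scaleRE; ring. Qed.

Lemma dotPr a u v w : dot w (a *: u + v) = a * dot w u + dot w v.
Proof. by rewrite dotC dotP !(dotC w). Qed.

Lemma dotZ a u w : dot (a *: u) w = a * dot u w.
Proof. by rewrite /dot /= !scaleRE; ring. Qed.

Lemma dotZr a u w : dot w (a *: u) = a * dot w u.
Proof. by rewrite dotC dotZ dotC. Qed.

Lemma dotBB u v : dot (u - v) (u - v) = dot u u - 2 * dot u v + dot v v.
Proof. by rewrite /dot /=; ring. Qed.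

Lemma dot_ge0 u : 0 <= dot u u.
Proof. by rewrite /dot -!expr2 !addr_ge0 ?sqr_ge0. Qed.

Lemma v3_eq u v : u.1.1 = v.1.1 -> u.1.2 = v.1.2 -> u.2 = v.2 -> u = v.
Proof. by case: u v => [[? ?] ?] [[? ?] ?] /= -> -> ->. Qed.

Lemma dot_eq0 u : dot u u = 0 -> u = 0.
Proof.
rewrite /dot -!expr2 => /eqP.
rewrite !paddr_eq0 ?addr_ge0 ?sqr_ge0// !sqrf_eq0 => /andP[/andP[/eqP h1 /eqP h2] /eqP h3].
exact: v3_eq.
Qed.

Lemma dist3E p q : dist3 p q = Num.sqrt (dot (p - q) (p - q)).
Proof. by rewrite /dist3 /dot /= !expr2. Qed.

Lemma dist3_dot p q p' q' :
  dist3 p q = dist3 p' q' <-> dot (p - q) (p - q) = dot (p' - q') (p' - q').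
Proof.
rewrite !dist3E; split=> [|->//] /eqP.
by rewrite eqr_sqrt ?dot_ge0// => /eqP.
Qed.

Section Orth.
Variables (A : R * R * R -> R * R * R).
Hypothesis oA : orth A.

Lemma orthP a u v : A (a *: u + v) = a *: A u + A v.
Proof. by have [] := oA. Qed.

Lemma orth_dot u v : dot (A u) (A v) = dot u v.
Proof. by have [] := oA. Qed.

Lemma orthD u v : A (u + v) = A u + A v.
Proof. by have := orthP 1 u v; rewrite !scale1r. Qed.

Lemma orth0 : A 0 = 0.
Proof. by have := orthD 0 0; rewrite addr0 => /eqP;
  rewrite -subr_eq0 opprD addrA subrr sub0r oppr_eq0 => /eqP. Qed.

Lemma orthZ a u : A (a *: u) = a *: A u.
Proof. by have := orthP a u 0; rewrite orth0 !addr0. Qed.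

Lemma orthN u : A (- u) = - A u.
Proof. by rewrite -scaleN1r orthZ scaleN1r. Qed.

Lemma orthB u v : A (u - v) = A u - A v.
Proof. by rewrite orthD orthN. Qed.

(** [A] preserves the norm of the linearity defect of [A'] and sends that defect to 0. *)
Lemma orth_inv A' : cancel A' A -> orth A'.
Proof.
move=> AK; split=> [a u v|u v]; last by rewrite -orth_dot !AK.
have /eqP : dot (A' (a *: u + v) - (a *: A' u + A' v)) (A' (a *: u + v) - (a *: A' u + A' v)) = 0.
  by rewrite -orth_dot orthB orthP !AK subrr /dot /= !mul0r !addr0.
by move=> /eqP/dot_eq0/eqP; rewrite subr_eq0 => /eqP.
Qed.

End Orth.

Lemma orth_comp (A B : R * R * R -> R * R * R) : orth A -> orth B -> orth (A \o B).
Proof.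
move=> oA oB; split=> [a u v|u v] /=; first by rewrite !orthP.
by rewrite !orth_dot.
Qed.

Lemma orth_opp (A : R * R * R -> R * R * R) : orth A -> orth (fun u => - A u).
Proof.
move=> oA; split=> [a u v|u v] /=; first by rewrite orthP// opprD scalerN.
by rewrite -(orth_dot oA u v) /dot /= !mulrNN.
Qed.

(** After subtracting [phi 0], norms are preserved, hence dot products by polarization; the squared
    norm of a linearity defect then expands into dot products that cancel. *)
Lemma isometry3_affine (phi : R * R * R -> R * R * R) : isometry3 phi ->
  exists b A A', [/\ orth A, orth A', cancel A A', cancel A' A &
    forall q, phi q = b + A q].
Proof.
move=> [[psi pK Kp] iso].
pose b := phi 0.
have [A defA] : exists A, forall q, A q = phi q - b by exists (fun q => phi q - b).
have [A' defA'] : exists A', forall q, A' q = psi (q + b).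
  by exists (fun q => psi (q + b)).
have AK : cancel A A' by move=> q; rewrite defA defA' subrK pK.
have KA : cancel A' A by move=> q; rewrite defA defA' Kp addrK.
have dA u v : dot (A u - A v) (A u - A v) = dot (u - v) (u - v).
  rewrite !defA opprB addrA subrK; exact/dist3_dot/iso.
have A0 : A 0 = 0 by rewrite defA subrr.
have nA u : dot (A u) (A u) = dot u u.
  by have := dA u 0; rewrite A0 !subr0.
have oA : forall u v, dot (A u) (A v) = dot u v.
  by move=> u v; have := dA u v; rewrite !dotBB !nA; lra.
have HA : orth A.
  split=> // a u v.
  apply/eqP; rewrite -subr_eq0; apply/eqP/dot_eq0.
  rewrite dotBB !(dotP, dotPr, oA); ring.
exists b, A, A'; split=> //; first exact: orth_inv KA.
by move=> q; rewrite defA addrC subrK.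
Qed.

Lemma affine_isometry3 b (A A' : R * R * R -> R * R * R) :
  orth A -> cancel A A' -> cancel A' A -> isometry3 (fun q => b + A q).
Proof.
move=> oA AK KA; split.
  exists (fun q => A' (q - b)) => q /=; first by rewrite addrC addKr AK.
  by rewrite KA addrC subrK.
move=> p q; apply/dist3_dot.
by rewrite opprD addrACA subrr add0r -orthB// orth_dot.
Qed.

(* The isometry [q |-> b + A q], whose linear part has inverse [A'], maps the
   graph of [f] onto that of [g]. *)
Definition moves (f g : R * R -> R) b (A A' : R * R * R -> R * R * R) : Prop :=
  [/\ orth A, orth A', cancel A A', cancel A' A &
    forall q, q.2 = f q.1 <-> (b + A q).2 = g (b + A q).1].

Lemma moves_inv f g b A A' : moves f g b A A' -> moves g f (- A' b) A' A.
Proof.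
move=> [oA oA' AK KA h]; split=> // q.
have := h (- A' b + A' q).
by rewrite -orthN// -orthD// KA addNKr => ->.
Qed.

Lemma moves_comp f g h b A A' b2 A2 A2' :
  moves f g b A A' -> moves g h b2 A2 A2' ->
  moves f h (b2 + A2 b) (A2 \o A) (A' \o A2').
Proof.
move=> [oA oA' AK KA h1] [oA2 oA2' AK2 KA2 h2].
split; [exact: orth_comp|exact: orth_comp|exact: can_comp|exact: can_comp|].
by move=> q /=; rewrite h1 h2 orthD// addrA.
Qed.

Lemma graphP (f : R * R -> R) q : graph f q <-> q.2 = f q.1.
Proof.
split=> [[p _ <-]//|]; case: q => p z /= ->; by exists p.
Qed.

Lemma isometry3_moves f g phi : isometry3 phi -> phi @` graph f = graph g ->
  exists b A A', moves f g b A A'.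
Proof.
move=> iphi im; have [b [A [A' [oA oA' AK KA e]]]] := isometry3_affine iphi.
exists b, A, A'; split=> // q; rewrite -!graphP -e -im.
split=> [h|[q' h]]; first by exists q.
by case: iphi => -[psi pK _] _; move=> /(can_inj pK) <-.
Qed.

Lemma moves_isometry3 f g b A A' : moves f g b A A' ->
  exists phi, isometry3 phi /\ phi @` graph f = graph g.
Proof.
move=> [oA oA' AK KA h]; exists (fun q => b + A q).
split; first exact: (@affine_isometry3 b A A').
apply/seteqP; split=> [_ [q /graphP hq <-]|q /graphP hq].
  by apply/graphP/h.
have e : b + A (A' (q - b)) = q by rewrite KA addrC subrK.
by exists (A' (q - b)) => //; apply/graphP/h; rewrite e.
Qed.

End Dot.

(** * Recurrence and elementary analysis *)

(** Pigeonhole principle: otherwise [C] would be a countable union of countable fibers. It serves to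
    select uncountably many scaling factors that share the same discrete datum. *)
Lemma uncountable_fiber {T I : Type} (C : set T) (E : set I) (P : T -> I -> Prop) :
  ~ countable C -> countable E -> (forall c, C c -> exists2 e, E e & P c e) ->
  exists2 e, E e & ~ countable [set c | C c /\ P c e].
Proof.
move=> nC cE h; apply: contrapT => no; apply: nC.
have sub : C `<=` \bigcup_(e in E) [set c | C c /\ P c e].
  by move=> c Cc; have [e Ee Pce] := h c Cc; exists e.
apply: sub_countable (subset_card_le sub) _.
apply: bigcup_countable => // e Ee; apply: contrapT => nc; apply: no.
by exists e.
Qed.

Lemma uncountable_neq {T : Type} (C : set T) x : ~ countable C ->
  exists2 c, C c & c <> x.
Proof.
move=> nC; apply: contrapT => no; apply: nC.
apply: (@sub_countable _ _ _ [set x]) (finite_set_countable (finite_set1 x)).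
apply: subset_card_le => c Cc; apply: contrapT => ne; apply: no.
by exists c.
Qed.

Lemma uncountable_image {T U : Type} (C : set T) (h : T -> U) :
  ~ countable C -> (forall x y, C x -> C y -> h x = h y -> x = y) ->
  ~ countable (h @` C).
Proof.
move=> nC inj; apply: contra_not nC => /countable_injP[g ginj].
apply/countable_injP; exists (g \o h) => x y /set_mem Cx /set_mem Cy /= e.
apply: inj => //; apply: ginj => //; apply/mem_set; [exact: imageP|exact: imageP].
Qed.

Lemma continuous_pair {T U V : topologicalType} (f : T -> U) (g : T -> V) :
  continuous f -> continuous g -> continuous (fun x => (f x, g x)).
Proof. by move=> cf cg x; apply: (cvg_pair (f := f) (g := g)); [exact: cf|exact: cg]. Qed.

Section Analysis.
Context {R : realType}.

Lemma ler_norm_pair {U V : normedModType R} (p : U * V) a :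
  (`|p| <= a) = (`|p.1| <= a) && (`|p.2| <= a).
Proof. by rewrite prod_normE ge_max. Qed.

Lemma ltr_norm_pair {U V : normedModType R} (p : U * V) a :
  (`|p| < a) = (`|p.1| < a) && (`|p.2| < a).
Proof. by rewrite prod_normE gt_max. Qed.

(** Bolzano-Weierstrass, phrased with recurring visits near [l] instead of a subsequence. *)
Lemma cluster_seq (u : nat -> R * R * R) M : (forall n, `|u n| <= M) ->
  exists l, forall e, 0 < e -> forall N, exists2 n, (N <= n)%N & `|u n - l| < e.
Proof.
move=> uM.
pose K : set (R * R * R) := (`[- M, M] `*` `[- M, M]) `*` `[- M, M].
have cK : compact K.
  by apply: compact_setX; [apply: compact_setX|]; exact: segment_compact.
have uK n : K (u n).
  have := uM n; rewrite !ler_norm_pair => /andP[/andP[h1 h2] h3].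
  by split; [split|]; rewrite /= in_itv /= -ler_norml.
have [|l [_ cl]] := cK (u n @[n --> \oo]) _; first by exists 0%N => // n _; exact: uK.
exists l => e e0 N.
have [||x [[n /= Nn <-] xe]] := cl (u @` [set n | (N <= n)%N]) (ball l e).
- by exists N => // n /= Nn; exists n.
- exact: nbhsx_ballx.
exists n => //; move: xe; rewrite -ball_normE /ball_ /=.
by rewrite distrC.
Qed.

(** Together with the next bound, this converts between the max norm, used for limits, and the
    Euclidean norm, which isometries preserve. *)
Lemma norm_sqr_le_dot (u : R * R * R) : `|u| ^+ 2 <= dot u u.
Proof.
have le0 := normr_ge0 u.
have [h|h] := leP `|u.1| `|u.2|.
  have -> : `|u| = `|u.2| by rewrite prod_normE; apply/max_idPr.
  by rewrite real_normK ?num_real// /dot; nra.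
have -> : `|u| = `|u.1| by rewrite prod_normE; apply/max_idPl/ltW.
have [h'|h'] := leP `|u.1.1| `|u.1.2|.
  have -> : `|u.1| = `|u.1.2| by rewrite prod_normE; apply/max_idPr.
  by rewrite real_normK ?num_real// /dot; nra.
have -> : `|u.1| = `|u.1.1| by rewrite prod_normE; apply/max_idPl/ltW.
by rewrite real_normK ?num_real// /dot; nra.
Qed.

Lemma dot_le_norm_sqr (u : R * R * R) : dot u u <= 3 * `|u| ^+ 2.
Proof.
have := lexx `|u|; rewrite {1}ler_norm_pair => /andP[].
rewrite ler_norm_pair => /andP[h1 h2] h3.
have sq (x : R) : `|x| <= `|u| -> x * x <= `|u| ^+ 2.
  by move=> h; rewrite -expr2 -(real_normK (num_real x)) lerXn2r// ?nnegrE.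
by rewrite /dot; have := sq _ h1; have := sq _ h2; have := sq _ h3; lra.
Qed.

(** Two iterates [n < m] lie close to a common cluster point; since [T] preserves distances, the
    first [n] steps can be undone, and the iterate of order [m - n] is close to [p]. *)
Lemma isometry_recurrent (T : R * R * R -> R * R * R) p M :
  (forall p q, dot (T p - T q) (T p - T q) = dot (p - q) (p - q)) ->
  (forall n, `|iter n T p| <= M) ->
  forall e, 0 < e -> exists k, `|iter k.+1 T p - p| < e.
Proof.
move=> iT bT e e0; have [l hl] := cluster_seq bT.
(* The two iterates end up within [e / 2] in max norm; passing to the Euclidean norm and back costs
   at most the square root of 3, which is less than 2. *)
have e4 : 0 < e / 4 by lra.
have [n _ hn] := hl _ e4 0%N.
have [m nm hm] := hl _ e4 n.+1.
pose k := (m - n.+1)%N; exists k.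
have itT j q r : dot (iter j T q - iter j T r) (iter j T q - iter j T r) = dot (q - r) (q - r).
  by elim: j => //= j <-; exact: iT.
have mE : m = (n + k.+1)%N by rewrite addnS -addSn subnKC.
have : `|iter m T p - iter n T p| < e / 2.
  have -> : iter m T p - iter n T p = (iter m T p - l) - (iter n T p - l)
    by rewrite opprB addrA subrK.
  by apply: (le_lt_trans (ler_normB _ _)); lra.
rewrite {1}mE iterD => h.
have := norm_sqr_le_dot (iter k.+1 T p - p); rewrite -(itT n).
have := dot_le_norm_sqr (iter n T (iter k.+1 T p) - iter n T p).
have := normr_ge0 (iter n T (iter k.+1 T p) - iter n T p).
move: h; set a := `|_ - iter n T p|; set b := `|_ - p|; set d := dot _ _.
move=> h1 h2 h3 h4; have b0 : 0 <= b by exact: normr_ge0.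
rewrite ltNge; apply/negP => h5; nra.
Qed.

Lemma continuous_norm {U V : normedModType R} (f : U -> V) p e :
  continuous f -> 0 < e -> exists2 d : R, 0 < d & forall q, `|q - p| < d -> `|f q - f p| < e.
Proof.
move=> cf e0; have := cf p => /cvgrPdist_lt /(_ e e0).
rewrite -nbhs_ballE => -[d d0 h]; exists d => // q qd.
rewrite distrC; apply: h; rewrite -ball_normE /= distrC //.
Qed.

Lemma IVT01 (h : R -> R) : continuous h -> h 0 < 0 -> 0 < h 1 ->
  exists2 s, 0 < s < 1 & h s = 0.
Proof.
move=> ch h0 h1.
have [||s] := @IVT R h 0 1 0 ler01; first exact: continuous_subspaceT.
  by rewrite ge_min le_max (ltW h0) (ltW h1) orbT.
rewrite in_itv /= => /andP[s0 s1] hs; exists s => //.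
by rewrite !lt_neqAle s0 s1 !andbT; apply/andP; split; apply/eqP => e; move: hs h0 h1;
  rewrite -?e ?e => ->; rewrite ltxx.
Qed.

(* [g t - g 1 * t] is additive and 1-periodic, hence bounded, hence zero. *)
Lemma additive_continuous_linear (g : R -> R) : continuous g ->
  (forall s t, g (s + t) = g s + g t) -> forall t, g t = g 1 * t.
Proof.
move=> cg ga.
pose h t := g t - g 1 * t.
have ch : continuous h.
  by move=> t; apply: cvgB; [exact: cg|apply: cvgM; [exact: cvg_cst|exact: cvg_id]].
have ha s t : h (s + t) = h s + h t by rewrite /h ga; ring.
have h1 : h 1 = 0 by rewrite /h mulr1 subrr.
have h0 : h 0 = 0 by have := ha 0 0; rewrite addr0; lra.
have hN t : h (- t) = - h t by have := ha t (- t); rewrite subrr h0; lra.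
have hn t n : h (t *+ n) = h t *+ n.
  by elim: n => [|n IH]; rewrite ?mulr0n// !mulrS ha IH.
have hz t (z : int) : h (t - z%:~R) = h t.
  rewrite ha hN (_ : h z%:~R = 0) ?subr0//.
  case: z => n; rewrite ?NegzE ?mulrNz ?hN.
    by rewrite -pmulrn hn h1 mul0rn.
  by rewrite -pmulrn hn h1 mul0rn oppr0.
have [M hM] : exists M, forall t, `|h t| <= M.
  have [c _ hc] := @EVT_max R (fun t => `|h t|) 0 1 ler01
    (continuous_subspaceT (fun t => cvg_norm (ch t))).
  exists (`|h c|) => t; rewrite -(hz t (Num.floor t)); apply: hc.
  have := floor_itv t; rewrite in_itv /= intrD => /andP[? ?].
  by apply/andP; split; lra.
move=> t; suff : h t = 0 by rewrite /h => /eqP; rewrite subr_eq0 => /eqP.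
apply/eqP/negPn/negP => ht.
have ht0 : 0 < `|h t| by rewrite normr_gt0.
pose n := (Num.bound (M / `|h t|)).
have : M / `|h t| < n%:R.
  apply: archi_boundP; rewrite divr_ge0//; exact: le_trans (normr_ge0 _) (hM 0).
rewrite ltr_pdivrMr//; have := hM (t *+ n).
rewrite hn normrMn -mulr_natl; lra.
Qed.
End Analysis.

(** * Multipliers *)

(** Form (ii) before the rotation that takes the x-axis to the unit direction [w]. *)
Definition exp_along {R : realType} (f : R * R -> R) : Prop :=
  exists (w : R * R) a k, [/\ w.1 ^+ 2 + w.2 ^+ 2 = 1, k != 0 &
    forall p t, f (p + t *: w) - a = expR (k * t) * (f p - a)].

Section Multipliers.
Context {R : realType}.
Variables (F : R * R -> R) (p0 : R * R).
Hypothesis cF : continuous F.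
Hypothesis F0 : F p0 != 0.

(** Cross-multiplied form of the statement that [F (p + u) / F p] does not depend on [p]: it
    tolerates zeros of [F], and both sides are continuous in [u]. *)
Definition multiplying u := forall p, F (p + u) * F p0 = F p * F (p0 + u).
Definition multiplier u := F (p0 + u) / F p0.

Lemma multiplierP u : multiplying u -> forall p, F (p + u) = multiplier u * F p.
Proof.
move=> h p; rewrite /multiplier mulrAC; apply/eqP.
by rewrite eq_sym (can2_eq (divfK F0) (mulfK F0)) h mulrC.
Qed.

Lemma multiplyingP u l : (forall p, F (p + u) = l * F p) -> multiplying u /\ multiplier u = l.
Proof. by move=> h; split=> [p|]; rewrite /multiplier !h ?mulfK//; ring. Qed.

Lemma multiplier_neq0 u : multiplying u -> multiplier u != 0.
Proof.
move=> h; apply: contra_neq F0 => e.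
by have := multiplierP h (p0 - u); rewrite subrK e mul0r.
Qed.

Lemma multiplyingD u v : multiplying u -> multiplying v ->
  multiplying (u + v) /\ multiplier (u + v) = multiplier u * multiplier v.
Proof.
move=> hu hv; apply: multiplyingP => p.
by rewrite addrA !multiplierP//; ring.
Qed.

Lemma multiplyingN u : multiplying u -> multiplying (- u).
Proof.
move=> hu; have [//|//] := @multiplyingP (- u) (multiplier u)^-1 _.
move=> p; rewrite -[in RHS](subrK u p) (multiplierP hu) mulKf//; exact: multiplier_neq0.
Qed.

Lemma multiplying0 : multiplying 0 /\ multiplier 0 = 1.
Proof. by apply: multiplyingP => p; rewrite addr0 mul1r. Qed.

Lemma multiplyingZ u (n : int) : multiplying u -> multiplying (n%:~R *: u).
Proof.
have nat m v : multiplying v -> multiplying (m%:R *: v).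
  move=> hv; elim: m => [|m IH]; first by rewrite scale0r; case: multiplying0.
  by rewrite -natr1 scalerDl scale1r; have [] := multiplyingD IH hv.
case: n => n hu; first exact: (nat n).
rewrite NegzE mulrNz scaleNr -scalerN; apply: (nat n.+1); exact: multiplyingN.
Qed.

Lemma multiplying_closed u :
  (forall e, 0 < e -> exists2 v, multiplying v & `|v - u| < e) -> multiplying u.
Proof.
move=> h p; apply/eqP; rewrite -subr_eq0; apply/negPn/negP.
rewrite -normr_gt0; set d := `|_| => d0.
(* Replacing [u] by [v] changes the two products by factors [F p0] and [F p] times the variation of
   [F], whence the tolerance [d / K]. *)
pose K := `|F p0| + `|F p|.
have K0 : 0 < K by rewrite /K ltr_pwDl ?normr_gt0// normr_ge0.
have e0 : 0 < d / K by rewrite divr_gt0.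
have [d1 d10 h1] := continuous_norm (p + u) cF e0.
have [d2 d20 h2] := continuous_norm (p0 + u) cF e0.
have [v hv vu] := h (Num.min d1 d2) (ltac:(by rewrite lt_min d10 d20)).
have {h1} := h1 (p + v); rewrite opprD addrACA subrr add0r => /(_ (lt_le_trans vu _)).
rewrite ge_min lexx => /(_ isT) h1.
have {h2} := h2 (p0 + v); rewrite opprD addrACA subrr add0r => /(_ (lt_le_trans vu _)).
rewrite ge_min lexx orbT => /(_ isT) h2.
have := hv p; move: h1 h2; rewrite /d.
set a := F (p + u); set a' := F (p + v); set b := F (p0 + u); set b' := F (p0 + v).
move=> h1 h2 e.
have : a * F p0 - F p * b = F p * (b' - b) - F p0 * (a' - a) by lra.
move=> E; have := ler_normB (F p * (b' - b)) (F p0 * (a' - a)).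
rewrite -E !normrM; apply/negP; rewrite -ltNge.
move: h1 h2; rewrite !ltr_pdivlMr//; move: K0; rewrite /K.
have := normr_ge0 (F p); have := F0; rewrite -normr_gt0.
set x := `|F p0|; set y := `|F p|; set s := `|a' - a|; set t := `|b' - b|.
move=> x0 y0 xy0 h1 h2; rewrite -(ltr_pM2r xy0).
have := ler_wpM2l y0 (ltW h2); have : x * (s * (x + y)) < x * d by rewrite ltr_pM2l.
by rewrite /d; lra.
Qed.

(** The multiplying vectors form a closed subgroup. Integer multiples of small members almost
    parallel to [w] come arbitrarily close to every [t *: w]. *)
Lemma multiplying_line w :
  (forall e, 0 < e -> exists u b, [/\ multiplying u, b != 0, `|b| < e &
     `|u - b *: w| <= e * `|b|]) ->
  forall t, multiplying (t *: w).
Proof.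
move=> h t; apply: multiplying_closed => e e0.
(* The error splits into at most [e' * (|t| + |b|)] from the deviation of [u] from [b *: w], and
   [|b| * |w|] from rounding [t / b]; with [|b| < e' <= 1] the total is at most [e' * K]. *)
pose K := `|t| + 1 + `|w|.
have K1 : 1 <= K by rewrite /K; have := normr_ge0 t; have := normr_ge0 w; lra.
pose e' := Num.min 1 (e / K / 2).
have e'0 : 0 < e' by rewrite lt_min ltr01 !divr_gt0//; lra.
have [u [b [hu b0 be ub]]] := h _ e'0.
pose n := Num.floor (t / b).
exists (n%:~R *: u); first exact: multiplyingZ.
have nb : `|t - n%:~R * b| <= `|b|.
  rewrite -{1}(divfK b0 t) -mulrBl normrM -[leRHS]mul1r ler_wpM2r//.
  have := floor_itv (t / b); rewrite -/n intrD ler_norml => /andP[? ?].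
  by apply/andP; split; lra.
have -> : n%:~R *: u - t *: w = n%:~R *: (u - b *: w) - (t - n%:~R * b) *: w.
  by rewrite scalerBr scalerBl scalerA opprB addrA subrK.
apply: (le_lt_trans (ler_normB _ _)); rewrite !normrZ.
have n0 : `|n%:~R * b| <= `|t| + `|b|.
  rewrite -[n%:~R * b](subKr t); apply: (le_trans (ler_normB _ _)); lra.
have e1 : e' <= 1 by rewrite ge_min lexx.
have e2 : e' * K < e.
  rewrite -ltr_pdivlMr; last by lra.
  have : e' <= e / K / 2 by rewrite ge_min lexx orbT.
  have : 0 < e / K by rewrite divr_gt0//; lra.
  lra.
apply: le_lt_trans e2; rewrite /K !mulrDr mulr1.
have := ler_wpM2l (normr_ge0 n%:~R) ub; rewrite mulrCA -normrM => h1.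
have := ler_wpM2l (ltW e'0) n0 => h2.
have := ler_wpM2r (normr_ge0 w) nb => h3.
have := ler_wpM2r (normr_ge0 w) (ltW be) => h4.
have : `|b| <= 1 by apply: ltW (lt_le_trans be e1).
nra.
Qed.

End Multipliers.

Lemma pair_eq {U V : Type} (p q : U * V) : p.1 = q.1 -> p.2 = q.2 -> p = q.
Proof. by case: p q => [? ?] [? ?] /= -> ->. Qed.

(** * Translations that act on values by affine maps *)

Section Translations.
Context {R : realType}.
Variable f : R * R -> R.
Hypothesis cf : continuous f.
Hypothesis nf : exists q0 q1, f q0 != f q1.

(* The small translations accumulate in some direction [w]. If the multipliers
   are all 1 along [w], their components orthogonal to [w] are translations with
   nontrivial multipliers, again arbitrarily small. *)
Lemma exp_along_small :
  (forall e, 0 < e -> exists u l v, [/\ `|u| < e, 0 < l, l != 1 &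
     forall p, f (p + u) = l * f p + v]) ->
  exp_along f.
Proof.
move=> small.
have [u0 [l0 [v0 [_ l00 l01 per0]]]] := small 1 ltr01.
have l01' : 1 - l0 != 0 by rewrite subr_eq0 eq_sym.
(* The fixed point of the affine map [y |-> l0 * y + v0]. *)
pose a := v0 / (1 - l0).
pose F p := f p - a.
have cF : continuous F by move=> p; apply: cvgB; [exact: cf|exact: cvg_cst].
have FF u l v : (forall p, f (p + u) = l * f p + v) -> forall p, F (p + u) = l * F p.
  move=> per p; rewrite /F per.
  (* Translations commute, so comparing [f (p + u + u0)] in both orders shows that [a] is fixed by
     all the affine maps at once. *)
  have -> : v = a * (1 - l).
    rewrite /a mulrAC; apply/(canRL (mulfK l01')).
    have := per0 (p + u); have := per (p + u0).
    by rewrite (addrAC p) => ->; rewrite per per0; lra.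
  ring.
have [p0 F0] : exists p0, F p0 != 0.
  have [q0 [q1 h]] := nf; have [e|ne] := eqVneq (F q0) 0; last by exists q0.
  exists q1; apply: contra_neq h => e1.
  by move: e e1; rewrite /F; lra.
have smallF e : 0 < e -> exists u, [/\ multiplying F p0 u, multiplier F p0 u != 1 & `|u| < e].
  move=> e0; have [u [l [v [ue l0' l1 per]]]] := small e e0.
  by exists u; have [? ->] := multiplyingP F0 (FF _ _ _ per).
have mul1_neq0 u : multiplier F p0 u != 1 -> u != 0.
  by apply: contra_neq => ->; have [] := multiplying0 F0.
have [w [w0 wl [t1 wt1]]] : exists w, [/\ w != 0, forall t, multiplying F p0 (t *: w) &
    exists t, multiplier F p0 (t *: w) != 1].
  have [us hus] : exists us : nat -> R * R, forall n,
      [/\ multiplying F p0 (us n), multiplier F p0 (us n) != 1 & `|us n| < n.+1%:R^-1].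
    have [us hus] := choice (fun n => smallF n.+1%:R^-1 (ltac:(by rewrite invr_gt0))).
    by exists us.
  have us0 n : 0 < `|us n| by rewrite normr_gt0; have [_ /mul1_neq0] := hus n.
  have us1 n : `| `|us n|^-1 *: us n| = 1.
    by rewrite normrZ normfV normr_id mulVf// gt_eqF.
  (* The planar unit vectors are padded with a zero coordinate to fit [cluster_seq]. *)
  have [|[w z] hw] := @cluster_seq R (fun n => (`|us n|^-1 *: us n, 0)) 1.
    by move=> n; rewrite ler_norm_pair /= us1 normr0 lexx ler01.
  have {}hw e : 0 < e -> exists u, [/\ multiplying F p0 u, multiplier F p0 u != 1, `|u| < e &
      `| `|u|^-1 *: u - w| < e].
    move=> e0; have [n] := hw e e0 (Num.bound e^-1).
    move=> Nn; rewrite ltr_norm_pair => /andP[/= h _]; exists (us n).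
    have [h1 h2 h3] := hus n; split=> //; apply: (lt_le_trans h3).
    rewrite invf_ple ?posrE//.
    apply/ltW/(lt_le_trans (archi_boundP _)); first by rewrite invr_ge0 ltW.
    by rewrite ler_nat; apply: leqW.
  have w0 : w != 0.
    apply/eqP => w0; have [u [_ /mul1_neq0 un0 _]] := hw 1 ltr01.
    by rewrite w0 subr0 normrZ normfV normr_id mulVf ?normr_eq0// ltxx.
  have wl : forall t, multiplying F p0 (t *: w).
    apply: multiplying_line => // e e0.
    have [u [hu /mul1_neq0 un0 ue uw]] := hw e e0.
    exists u, `|u|; split => //; rewrite ?normr_eq0 ?normr_id//.
    rewrite -[X in X - _](scale1r u) -(mulfV (_ : `|u| != 0)) ?normr_eq0//.
    by rewrite -scalerA -scalerBr normrZ normr_id mulrC ler_wpM2r// ltW.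
  have [ht|hn] := pselect (exists t, multiplier F p0 (t *: w) != 1).
    by exists w.
  have {}hn t : multiplier F p0 (t *: w) = 1.
    by apply/eqP/negPn/negP => h; apply: hn; exists t.
  pose N := w.1 ^+ 2 + w.2 ^+ 2.
  have N0 : 0 < N.
    rewrite lt_neqAle addr_ge0 ?sqr_ge0// andbT eq_sym paddr_eq0 ?sqr_ge0//.
    rewrite !sqrf_eq0; apply: contra w0 => /andP[/eqP e1 /eqP e2].
    exact/eqP/pair_eq.
  pose w' : R * R := (- w.2, w.1).
  have w'0 e : 0 < e -> exists b, [/\ multiplying F p0 (b *: w'), b != 0, `|b| < e &
     multiplier F p0 (b *: w') != 1].
    move=> e0.
    have K0 : 0 < 2 * (`|w| + 1) / N by rewrite divr_gt0// mulr_gt0// ltr_wpDl.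
    have [u [hu u1 ue]] := smallF (e / (2 * (`|w| + 1) / N)) (divr_gt0 e0 K0).
    (* [al] and [b] are the coordinates of [u] in the orthogonal basis [w], [w']. Removing [al *: w]
       leaves the multiplier unchanged, since multipliers along [w] are 1 here. *)
    pose al := (w.1 * u.1 + w.2 * u.2) / N.
    pose b := (w.1 * u.2 - w.2 * u.1) / N.
    have uE : b *: w' = u + (- al) *: w.
      rewrite [u]surjective_pairing [w]surjective_pairing /w' /b /al.
      apply/eqP; rewrite xpair_eqE /=; apply/andP; split; apply/eqP; rewrite !scaleRE;
        rewrite /N; field; exact: lt0r_neq0.
    have [hb mb] := multiplyingD F0 hu (wl (- al)).
    rewrite hn mulr1 -uE in mb; rewrite -uE in hb.
    exists b; split => //; rewrite ?mb//.
      by have := mul1_neq0 (b *: w'); rewrite mb => /(_ u1); apply: contra_neq => ->;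
        rewrite scale0r.
    move: ue; rewrite ltr_pdivlMr// mulrA ltr_pdivrMr// => ue.
    rewrite /b normrM normfV (gtr0_norm N0) ltr_pdivrMr//; apply: le_lt_trans ue.
    have := lexx `|w|; rewrite {1}ler_norm_pair => /andP[w1 w2].
    have := lexx `|u|; rewrite {1}ler_norm_pair => /andP[v1 v2].
    apply: (le_trans (ler_normB _ _)); rewrite !normrM.
    have := ler_pM (normr_ge0 _) (normr_ge0 _) w1 v2.
    have := ler_pM (normr_ge0 _) (normr_ge0 _) w2 v1.
    have := normr_ge0 u; lra.
  exists w'; split.
  - apply: contra_neq w0 => -[/eqP]; rewrite oppr_eq0 => /eqP e2 e1.
    exact: pair_eq.
  - apply: multiplying_line => // e e0; have [b [h1 h2 h3 _]] := w'0 e e0.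
    exists (b *: w'), b; split => //; rewrite subrr normr0 mulr_ge0// ltW//.
  - by have [b [_ _ _ h]] := w'0 1 ltr01; exists b.
pose N := Num.sqrt (w.1 ^+ 2 + w.2 ^+ 2).
have N2 : N ^+ 2 = w.1 ^+ 2 + w.2 ^+ 2 by rewrite sqr_sqrtr// addr_ge0 ?sqr_ge0.
have N0 : N != 0.
  rewrite -sqrf_eq0 N2 paddr_eq0 ?sqr_ge0// !sqrf_eq0.
  apply: contra w0 => /andP[/eqP e1 /eqP e2].
  exact/eqP/pair_eq.
pose w1 := N^-1 *: w.
have w1l t : multiplying F p0 (t *: w1) by rewrite scalerA.
pose mu t := multiplier F p0 (t *: w1).
have muD s t : mu (s + t) = mu s * mu t.
  by rewrite /mu scalerDl; have [] := multiplyingD F0 (w1l s) (w1l t).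
(* [mu t] is the square of [mu (t / 2)], so a logarithm may be taken. *)
have mu0 t : 0 < mu t.
  rewrite [t]splitr muD -expr2 exprn_even_gt0//; exact: multiplier_neq0.
have cmu : continuous mu.
  have cFw : continuous (fun t : R => F (p0 + t *: w1)).
    move=> t; apply: (@continuous_comp R (R * R)%type R (fun t => p0 + t *: w1) F);
      last exact: cF.
    by apply: cvgD; [exact: cvg_cst|apply: cvgZr_tmp; exact: cvg_id].
  by move=> t; apply: cvgM; [exact: cFw|exact: cvg_cst].
have lnmu t : ln (mu t) = ln (mu 1) * t.
  apply: (@additive_continuous_linear R (fun t => ln (mu t))) => [s|s r].
    by apply: (@continuous_comp R R R mu (@ln R)); [exact: cmu|exact: continuous_ln].
  by rewrite muD lnM ?posrE.
have muE t : mu t = expR (ln (mu 1) * t) by rewrite -lnmu lnK ?posrE.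
exists w1, a, (ln (mu 1)); split.
- by rewrite /w1 /= !scaleRE !exprMn -mulrDr -N2 exprVn mulVf// expf_neq0.
- apply: contra_neq wt1 => k0.
  have := muE (t1 * N); rewrite k0 mul0r expR0 /mu /w1 scalerA mulfK//.
- move=> p t; rewrite -muE -/(F p) -/(F (p + t *: w1)).
  exact: (multiplierP F0 (w1l t)).
Qed.

(** Cut the plane into square cells of side [e]. Two different factors whose translation vectors
    share a cell give, by taking the quotient, a translation shorter than [e] whose multiplier is
    not 1. *)
Lemma exp_along_translations {T : Type} (C : set T) (lam : T -> R) :
  ~ countable C -> (forall c, C c -> 0 < lam c) ->
  (forall c d, C c -> C d -> lam c = lam d -> c = d) ->
  (forall c, C c -> exists u v, forall p, f (p + u) = lam c * f p + v) ->
  exp_along f.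
Proof.
move=> nC lam0 laminj h; apply: exp_along_small => e e0.
pose P c (z : int * int) := exists u v, [/\ forall p, f (p + u) = lam c * f p + v,
  Num.floor (u.1 / e) = z.1 & Num.floor (u.2 / e) = z.2].
have [|||z _ nz] := @uncountable_fiber T (int * int)%type C setT P => //.
  move=> c Cc; have [u [v huv]] := h c Cc.
  by exists (Num.floor (u.1 / e), Num.floor (u.2 / e)) => //; exists u, v.
have [c1] : [set c | C c /\ P c z] !=set0.
  by apply/set0P/eqP => e0'; apply: nz; rewrite e0'; exact: countable0.
move=> [C1 [u1 [v1 [p1 f11 f12]]]].
have [c2 [C2 [u2 [v2 [p2 f21 f22]]]] ne] := uncountable_neq c1 nz.
have l1 := lam0 _ C1; have l2 := lam0 _ C2.
have close x y (k : int) : Num.floor (x / e) = k -> Num.floor (y / e) = k -> `|x - y| < e.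
  move=> hx hy; have := floor_itv (x / e); have := floor_itv (y / e).
  rewrite hx hy intrD !ler_pdivlMr// !ltr_pdivrMr// ltr_norml.
  by move=> /andP[? ?] /andP[? ?]; apply/andP; split; lra.
exists (u1 - u2), (lam c1 / lam c2), ((v1 - v2) / lam c2); split.
- by rewrite ltr_norm_pair /= (close _ _ _ f11 f21) (close _ _ _ f12 f22).
- exact: divr_gt0.
- apply/eqP => e1; apply: ne; apply: laminj => //.
  by rewrite -[lam c1](divfK (lt0r_neq0 l2)) e1 mul1r.
- move=> p; have := p2 (p + (u1 - u2)); rewrite addrA subrK p1 => E.
  transitivity ((lam c1 * f p + v1 - v2) / lam c2); last by field; exact: lt0r_neq0.
  by apply: (canRL (mulfK (lt0r_neq0 l2))); move: E; lra.
Qed.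
End Translations.

(** * Isometries fixing the vertical direction *)

Section Endgame.
Context {R : realType}.
Implicit Types f g h : R * R -> R.

(* Otherwise the motion has a fixed point [o]; every orbit is then bounded, hence
   recurrent, while [f - f o] is multiplied by a constant other than 1 at each
   step, so that [f] is constant. *)
Lemma similarity_translation f mu al be b1 b2 ga :
  continuous f -> (exists q0 q1, f q0 != f q1) ->
  0 < mu -> mu != 1 -> al ^+ 2 + be ^+ 2 = 1 ->
  (forall x y, mu * f (al * x - be * y + b1, be * x + al * y + b2) = f (x, y) + ga) ->
  al = 1 /\ be = 0.
Proof.
move=> cf [q0 [q1 nq]] mu0 mu1 ab hf.
apply: contrapT => nab.
have D0 : 0 < (1 - al) ^+ 2 + be ^+ 2.
  rewrite lt_neqAle addr_ge0 ?sqr_ge0// andbT eq_sym paddr_eq0 ?sqr_ge0//.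
  rewrite !sqrf_eq0; apply/negP => /andP[/eqP e1 /eqP e2]; apply: nab.
  by split => //; lra.
set D := _ + _ in D0; have D0' : D != 0 by rewrite gt_eqF.
(* Cramer's rule for the fixed point of the motion; [D] is the determinant of the identity minus the
   rotation. *)
pose o1 := ((1 - al) * b1 - be * b2) / D.
pose o2 := ((1 - al) * b2 + be * b1) / D.
have E1 : al * o1 - be * o2 + b1 = o1 by rewrite /o1 /o2 /D; field.
have E2 : be * o1 + al * o2 + b2 = o2 by rewrite /o1 /o2 /D; field.
pose F p := f p - f (o1, o2).
have FT x y : F (al * x - be * y + b1, be * x + al * y + b2) = mu^-1 * F (x, y).
  apply: (mulfI (lt0r_neq0 mu0)); rewrite mulVKf ?gt_eqF//.
  have := hf x y; have := hf o1 o2; rewrite /F E1 E2; lra.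
(* The planar motion is extended by the identity on the third axis so that [isometry_recurrent]
   applies. *)
pose T (p : R * R * R) : R * R * R :=
  (al * p.1.1 - be * p.1.2 + b1, be * p.1.1 + al * p.1.2 + b2, p.2).
have isoT p q : dot (T p - T q) (T p - T q) = dot (p - q) (p - q).
  rewrite /dot /T /=; set u := p.1.1; set v := q.1.1; set u' := p.1.2; set v' := q.1.2.
  transitivity ((al ^+ 2 + be ^+ 2) * ((u - v) * (u - v) + (u' - v') * (u' - v'))
    + (p.2 - q.2) * (p.2 - q.2)); first by ring.
  by rewrite ab mul1r.
have F0 x y : F (x, y) = 0.
  pose p : R * R * R := (x, y, 0); pose o : R * R * R := (o1, o2, 0).
  have To : T o = o by rewrite /T /o /= E1 E2.
  have itT n : dot (iter n T p - o) (iter n T p - o) = dot (p - o) (p - o).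
    by elim: n => //= n IH; rewrite -{1 2}To isoT.
  have bT n : `|iter n T p| <= `|o| + 1 + dot (p - o) (p - o).
    have := norm_sqr_le_dot (iter n T p - o); rewrite itT.
    have := ler_normD (iter n T p - o) o; rewrite subrK.
    have := normr_ge0 (iter n T p - o); set z := `|_ - o|; set d := dot _ _; nra.
  have itF n : F (iter n T p).1 = mu^-1 ^+ n * F (x, y).
    by elim: n => [|n IH]; rewrite ?mul1r// iterS FT -surjective_pairing IH exprS mulrA.
  have r0 : 0 < mu^-1 by rewrite invr_gt0.
  have r1 : mu^-1 != 1 by rewrite invr_eq1.
  (* Positive powers of a positive number other than 1 stay at least as far from 1 as the number
     itself, which contradicts recurrence at a point where [F] is nonzero. *)
  have rk k : `|mu^-1 - 1| <= `|mu^-1 ^+ k.+1 - 1|.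
    have [rl|rg] := ltP mu^-1 1.
      have h : mu^-1 ^+ k.+1 <= mu^-1 by rewrite exprS ger_pMr// exprn_ile1// ltW.
      by rewrite !ler0_norm; lra.
    have h : mu^-1 <= mu^-1 ^+ k.+1 by rewrite exprS ler_peMr ?exprn_ege1// ltW.
    by rewrite !ger0_norm; lra.
  apply/eqP/negPn/negP => nF.
  have e0 : 0 < `|F (x, y)| * `|mu^-1 - 1| by rewrite mulr_gt0// normr_gt0// subr_eq0.
  have cF : continuous F by move=> q; apply: cvgB; [exact: cf|exact: cvg_cst].
  have [d d0 hd] := continuous_norm (x, y) cF e0.
  have [k] := isometry_recurrent isoT bT d0.
  rewrite ltr_norm_pair => /andP[/hd + _]; rewrite itF.
  have -> : mu^-1 ^+ k.+1 * F (x, y) - F (x, y) = F (x, y) * (mu^-1 ^+ k.+1 - 1) by ring.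
  by rewrite normrM ltr_pM2l ?normr_gt0// ltNge rk.
move: nq; rewrite [q0]surjective_pairing [q1]surjective_pairing.
have := F0 q0.1 q0.2; have := F0 q1.1 q1.2; rewrite /F => h1 h2.
by apply/negP; rewrite negbK; apply/eqP; lra.
Qed.

(** A linear isometry fixing [e3] preserves the horizontal plane; [(p, q)] and [(r, s)] are the
    images of the two horizontal basis vectors. *)
Lemma moves_vertical g h b (A A' : R * R * R -> R * R * R) :
  moves g h b A A' -> A (0, 0, 1) = (0, 0, 1) ->
  exists p q r s b1 b2 be, [/\ p ^+ 2 + q ^+ 2 = 1, r ^+ 2 + s ^+ 2 = 1, p * r + q * s = 0 &
    forall x y, h (p * x + r * y + b1, q * x + s * y + b2) = g (x, y) + be].
Proof.
move=> [oA oA' AK KA hgh] A3.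
have z1 : (A (1, 0, 0)).2 = 0.
  have := orth_dot oA (1, 0, 0) (0, 0, 1); rewrite A3 /dot /=; lra.
have z2 : (A (0, 1, 0)).2 = 0.
  have := orth_dot oA (0, 1, 0) (0, 0, 1); rewrite A3 /dot /=; lra.
exists (A (1, 0, 0)).1.1, (A (1, 0, 0)).1.2, (A (0, 1, 0)).1.1, (A (0, 1, 0)).1.2,
  b.1.1, b.1.2, b.2; split.
- have := orth_dot oA (1, 0, 0) (1, 0, 0); rewrite /dot z1 /=; lra.
- have := orth_dot oA (0, 1, 0) (0, 1, 0); rewrite /dot z2 /=; lra.
- have := orth_dot oA (1, 0, 0) (0, 1, 0); rewrite /dot z1 z2 /=; lra.
move=> x y; have := hgh (x, y, g (x, y)) => -[/(_ erefl) + _].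
have -> : (x, y, g (x, y)) = x *: (1, 0, 0) + (y *: (0, 1, 0) + g (x, y) *: (0, 0, 1)).
  by apply: v3_eq; rewrite /= !scaleRE; ring.
rewrite !(orthP oA) (orthZ oA) A3 /= z1 z2 !scaleRE => e.
transitivity (b.2 + (x * 0 + (y * 0 + g (x, y) * 1))); last by ring.
by rewrite e; congr h; apply: pair_eq => /=; rewrite !scaleRE; ring.
Qed.

(* The planar part of the motion is squared because it may be a reflection,
   whose square is the identity. *)
Lemma moves_vertical_translation f b (A A' : R * R * R -> R * R * R) c c0 :
  continuous f -> (exists q0 q1, f q0 != f q1) -> 0 < c -> 0 < c0 ->
  moves (fun p => c0 * f p) (fun p => c * f p) b A A' -> A (0, 0, 1) = (0, 0, 1) ->
  exists u v, forall p, f (p + u) = (c0 / c) ^+ 2 * f p + v.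
Proof.
move=> cf nf cp c0p m A3; have cn := lt0r_neq0 cp; have c0n := lt0r_neq0 c0p.
have [<-|ne] := eqVneq c c0.
  by exists 0, 0 => p; rewrite divff// expr1n mul1r !addr0.
have [p [q [r [s [b1 [b2 [be [pq rs prqs hf]]]]]]]] := moves_vertical m A3.
pose rho := c / c0; have rho0 : 0 < rho by rewrite divr_gt0.
pose ga := be / c0.
have hf' x y : rho * f (p * x + r * y + b1, q * x + s * y + b2) = f (x, y) + ga.
  by rewrite /rho /ga mulrAC hf; field.
have rs' : (s = p /\ r = - q) \/ (s = - p /\ r = q).
  (* The determinant of the planar part; [d ^+ 2 = 1] by Lagrange's identity, and its sign separates
     rotations from reflections. *)
  pose d := p * s - q * r.
  have d2 : (d - 1) * (d + 1) = 0.
    transitivity ((p ^+ 2 + q ^+ 2) * (r ^+ 2 + s ^+ 2) - (p * r + q * s) ^+ 2 - 1).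
      by rewrite /d; ring.
    by rewrite pq rs prqs; ring.
  have es : s = d * p.
    transitivity (s * (p ^+ 2 + q ^+ 2)); first by rewrite pq mulr1.
    transitivity (d * p + q * (p * r + q * s)); first by rewrite /d; ring.
    by rewrite prqs mulr0 addr0.
  have er : r = - (d * q).
    transitivity (r * (p ^+ 2 + q ^+ 2)); first by rewrite pq mulr1.
    transitivity (- (d * q) + p * (p * r + q * s)); first by rewrite /d; ring.
    by rewrite prqs mulr0 addr0.
  move/eqP: d2; rewrite mulf_eq0 subr_eq0 addr_eq0 => /orP[]/eqP de.
    by left; rewrite es er de !mul1r.
  by right; rewrite es er de !mulN1r opprK.
(* First column of the square of the planar part; [c1] and [c2] give the translation part of the
   squared motion. *)
pose al := p ^+ 2 + r * q; pose bb := q * p + s * q.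
pose c1 := p * b1 + r * b2 + b1; pose c2 := q * b1 + s * b2 + b2.
have e1 : p * r + r * s = - bb by rewrite /bb; case: rs' => -[-> ->]; ring.
have e2 : q * r + s ^+ 2 = al by rewrite /al; case: rs' => -[-> ->]; ring.
have ab : al ^+ 2 + bb ^+ 2 = 1.
  transitivity ((p ^+ 2 + q ^+ 2) ^+ 2); last by rewrite pq expr1n.
  by rewrite /al /bb; case: rs' => -[-> ->]; ring.
have hf2 x y : rho ^+ 2 * f (al * x - bb * y + c1, bb * x + al * y + c2) =
    f (x, y) + (ga + rho * ga).
  rewrite expr2 -mulrA.
  have -> : (al * x - bb * y + c1, bb * x + al * y + c2) =
    (p * (p * x + r * y + b1) + r * (q * x + s * y + b2) + b1,
     q * (p * x + r * y + b1) + s * (q * x + s * y + b2) + b2).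
    congr (_, _).
      by rewrite -mulNr -e1 /al /c1; ring.
    by rewrite -e2 /bb /c2; ring.
  by rewrite hf' mulrDr hf'; ring.
have [al1 bb0] : al = 1 /\ bb = 0.
  apply: (similarity_translation cf nf _ _ ab hf2); first by rewrite exprn_gt0.
  rewrite sqrf_eq1; apply/norP; split.
    by rewrite /rho; apply: contra ne => /eqP e; rewrite -(divfK c0n c) e mul1r.
  by rewrite gt_eqF//; lra.
exists (c1, c2), ((c0 / c) ^+ 2 * (ga + rho * ga)) => -[x y].
have := hf2 x y; rewrite al1 bb0 !mul1r !mul0r subr0 add0r => e.
rewrite -mulrDr -e /rho mulrA -exprMn.
by rewrite mulrA divfK // divff// expr1n mul1r.
Qed.

(** By pigeonhole, uncountably many [c] have the same [A' e3]. Undoing the motion for [c0] and then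
    applying the one for [c] fixes the vertical direction, so it yields a translation with
    multiplier [(c0 / c) ^+ 2]. *)
Lemma exp_along_moves f (C : set R) (E : set (R * R * R)) :
  continuous f -> (exists q0 q1, f q0 != f q1) ->
  ~ countable C -> (forall c, C c -> 0 < c) -> countable E ->
  (forall c, C c -> exists b A A', moves f (fun p => c * f p) b A A' /\ E (A' (0, 0, 1))) ->
  exp_along f.
Proof.
move=> cf nf nC C0 cE hC.
pose P c e := exists b A A', moves f (fun p => c * f p) b A A' /\ A' (0, 0, 1) = e.
have [|e Ee ne] := uncountable_fiber (P := P) nC cE.
  move=> c Cc; have [b [A [A' [m h]]]] := hC c Cc.
  by exists (A' (0, 0, 1)) => //; exists b, A, A'.
have [c0 [Cc0 [b0 [A0 [A0' [m0 h0]]]]]] : [set c | C c /\ P c e] !=set0.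
  by apply/set0P/eqP => e0'; apply: ne; rewrite e0'; exact: countable0.
apply: (exp_along_translations cf nf (lam := fun c => (c0 / c) ^+ 2) ne).
- by move=> c [Cc _]; rewrite exprn_gt0// divr_gt0// C0.
- move=> c d [/C0 c_gt0 _] [/C0 d_gt0 _] /eqP; have c0_gt0 := C0 _ Cc0.
  rewrite eqrXn2 ?ltW ?divr_gt0// => /eqP/(mulfI (lt0r_neq0 c0_gt0)).
  exact: invr_inj.
- move=> c [Cc [b [A [A' [m h]]]]].
  apply: (moves_vertical_translation cf nf (C0 _ Cc) (C0 _ Cc0)
    (moves_comp (moves_inv m0) m)) => /=.
  by rewrite h0 -h; case: m => _ _ _ ->.
Qed.

End Endgame.

(** * The cone of slopes *)

Section SlopeCone.
Context {R : realType}.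
Implicit Types (f g h : R * R -> R) (u v w : R * R * R).

Definition e3 : R * R * R := (0, 0, 1).

(* [w = (v, z)] is in the cone iff [z] dominates every slope of [f] in the
   direction [v]. *)
Definition slope_cone f w : Prop :=
  forall (t : R) (p : R * R), 0 <= t -> f (p + t *: w.1) <= f p + t * w.2.

Definition strict_slope_cone f w : Prop :=
  forall (t : R) (p : R * R), 0 < t -> f (p + t *: w.1) < f p + t * w.2.

Definition chord f w : Prop :=
  exists (t : R) (p : R * R), 0 < t /\ f (p + t *: w.1) = f p + t * w.2.

Lemma slope_coneD f u v : slope_cone f u -> slope_cone f v -> slope_cone f (u + v).
Proof.
move=> hu hv t p t0; rewrite /= scalerDr addrA.
by apply: le_trans (hv _ _ t0) _; have := hu t p t0; lra.
Qed.

Lemma slope_coneZ f a u : 0 <= a -> slope_cone f u -> slope_cone f (a *: u).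
Proof.
move=> a0 hu t p t0; rewrite /= !scaleRE scalerA mulrA.
by apply: hu; rewrite mulr_ge0.
Qed.

Lemma slope_cone_e3 f : slope_cone f e3.
Proof. by move=> t p t0; rewrite /= scaler0 addr0; lra. Qed.

Lemma slope_cone_Ne3 f : ~ slope_cone f (- e3).
Proof. by move=> /(_ 1 0 ler01) /=; rewrite oppr0 scaler0 addr0; lra. Qed.

Lemma slope_cone_closed f w : continuous f ->
  (forall e, 0 < e -> exists2 v, slope_cone f v & `|v - w| < e) -> slope_cone f w.
Proof.
move=> cf h t p t0; rewrite leNgt; apply/negP => hlt.
pose d := f (p + t *: w.1) - (f p + t * w.2).
have d0 : 0 < d / 2 by rewrite /d; lra.
have t1 : 0 < t + 1 by lra.
have [r r0 hr] := continuous_norm (p + t *: w.1) cf d0.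
have [|v hv] := h (Num.min (r / (t + 1)) (d / 2 / (t + 1))).
  by rewrite lt_min (divr_gt0 r0 t1) (divr_gt0 d0 t1).
rewrite lt_min !ltr_pdivlMr// => /andP[h1 h2].
have := lexx `|v - w|; rewrite {1}ler_norm_pair /= => /andP[n1 n2].
have n0 := normr_ge0 (v - w).
have close : `|p + t *: v.1 - (p + t *: w.1)| < r.
  rewrite opprD addrACA subrr add0r -scalerBr normrZ (ger0_norm t0).
  by apply: le_lt_trans h1; nra.
have := hr _ close; rewrite ltr_norml => /andP[h3 _].
have := hv t p t0; move: n2; rewrite ler_norml => /andP[_ n2].
have : t * (v.2 - w.2) <= t * `|v - w| by rewrite ler_wpM2l.
rewrite /d in h2 h3; nra.
Qed.

Lemma strict_slope_coneW f w : strict_slope_cone f w -> slope_cone f w.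
Proof.
move=> h t p; rewrite le_eqVlt => /predU1P[<-|/h]; last by move=> /(_ p)/ltW.
by rewrite scale0r mul0r !addr0.
Qed.

(** This makes strict directions dense in the cone; strictness is what can be tested by chords, and
    chords are what motions carry over. *)
Lemma slope_cone_strict f w e : 0 < e -> slope_cone f w -> strict_slope_cone f (w + e *: e3).
Proof.
move=> e0 h t p t0; rewrite /= !scaler0 !scaleRE.
have -> : w.1 + (0, 0) = w.1 by apply: pair_eq; rewrite /= addr0.
by apply: le_lt_trans (h t p (ltW t0)) _; nra.
Qed.

Lemma strict_slope_cone_conv f u v s : 0 < s < 1 ->
  strict_slope_cone f u -> strict_slope_cone f v ->
  strict_slope_cone f (u + s *: (v - u)).
Proof.
move=> /andP[s0 s1] hu hv t p t0 /=.
have -> : t *: (u.1 + s *: (v.1 - u.1)) = (t * (1 - s)) *: u.1 + (t * s) *: v.1.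
  rewrite scalerDr scalerA scalerBr mulrBr mulr1 scalerBl -[RHS]addrA; congr (_ + _).
  exact: addrC.
rewrite addrA scaleRE.
have := hv (t * s) (p + (t * (1 - s)) *: u.1) (mulr_gt0 t0 s0).
have s1' : 0 < 1 - s by lra.
have := hu (t * (1 - s)) p (mulr_gt0 t0 s1').
lra.
Qed.

Lemma strict_slope_cone_nchord f w : strict_slope_cone f w -> ~ chord f w.
Proof. by move=> h [t [p [t0 e]]]; have := h t p t0; rewrite e ltxx. Qed.

(** The pairs [(t, p)] with [t > 0] form a convex set on which [f (p + t *: w.1) - f p - t * w.2]
    has no zero, hence a constant sign. *)
Lemma nchord_strict f w : continuous f -> ~ chord f w ->
  strict_slope_cone f w \/ strict_slope_cone f (- w).
Proof.
move=> cf nch; apply: contrapT => /not_orP[/existsNP[t1 /existsNP[p1 h1]] /existsNP[t2 /existsNP[p2 h2]]].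
have [t10 {}h1] : 0 < t1 /\ f p1 + t1 * w.2 < f (p1 + t1 *: w.1).
  move/not_implyP: h1 => [t10 /negP]; rewrite -leNgt le_eqVlt => /predU1P[e|//].
  by case: nch; exists t1, p1.
have [t20 {}h2] : 0 < t2 /\ f p2 < f (p2 - t2 *: w.1) + t2 * w.2.
  move/not_implyP: h2 => [t20 /negP]; rewrite -leNgt /= scalerN mulrN => h.
  split => //; rewrite lt_neqAle; apply/andP; split; last by lra.
  apply: contra_notN nch => /eqP e; exists t2, (p2 - t2 *: w.1).
  by rewrite subrK.
pose q2 := p2 - t2 *: w.1.
(* The straight path from [(t2, q2)], where the difference is negative, to [(t1, p1)], where it is
   positive. *)
pose tt s := t2 + s * (t1 - t2); pose pp s := q2 + s *: (p1 - q2).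
pose k s := f (pp s + tt s *: w.1) - (f (pp s) + tt s * w.2).
have ctt : continuous tt.
  by move=> s; apply: cvgD; [exact: cvg_cst|apply: cvgM; [exact: cvg_id|exact: cvg_cst]].
have cpp : continuous pp.
  by move=> s; apply: cvgD; [exact: cvg_cst|apply: cvgZr_tmp; exact: cvg_id].
have ck : continuous k.
  move=> s; apply: cvgB.
    apply: (@continuous_comp R (R * R)%type R (fun s => pp s + tt s *: w.1) f); last exact: cf.
    by apply: cvgD; [exact: cpp|apply: cvgZr_tmp; exact: ctt].
  apply: cvgD; last by apply: cvgM; [exact: ctt|exact: cvg_cst].
  by apply: (@continuous_comp R (R * R)%type R pp f); [exact: cpp|exact: cf].
have [||s /andP[s0 s1] ks] := IVT01 ck.
- rewrite /k /pp /tt scale0r mul0r !addr0 /q2 subrK; lra.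
- have -> : k 1 = f (p1 + t1 *: w.1) - (f p1 + t1 * w.2); last by lra.
  have pp1 : pp 1 = p1 by rewrite /pp scale1r addrC subrK.
  have tt1 : tt 1 = t1 by rewrite /tt mul1r addrC subrK.
  by rewrite /k pp1 tt1.
apply: nch; exists (tt s), (pp s); split; last by move: ks; rewrite /k; lra.
rewrite /tt; nra.
Qed.

Lemma chord_moves f g b A A' w : moves f g b A A' -> chord f w -> chord g (A w).
Proof.
move=> [oA _ _ _ h] [t [p [t0 e]]].
have /h e1 : (p, f p).2 = f (p, f p).1 by [].
have /h : ((p, f p) + t *: w).2 = f ((p, f p) + t *: w).1 by rewrite /= e.
rewrite (orthD oA) (orthZ oA) addrA => e2.
exists t, (b + A (p, f p)).1; split => //.
by rewrite -e1; symmetry; exact: e2.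
Qed.

Section Moves.
Variables (f g : R * R -> R) (b : R * R * R) (A A' : R * R * R -> R * R * R).
Hypotheses (cg : continuous g) (m : moves f g b A A').

(* [A] cannot send one strict direction up and another one down: by the
   intermediate value theorem, some direction on the segment joining the images
   would be that of a chord. *)
Lemma strict_slope_cone_moves :
  (forall w, strict_slope_cone f w -> strict_slope_cone g (A w)) \/
  (forall w, strict_slope_cone f w -> strict_slope_cone g (- A w)).
Proof.
have nch w : strict_slope_cone f w -> ~ chord g (A w).
  move=> /strict_slope_cone_nchord nc ch; apply: nc.
  have [_ _ AK _ _] := m; rewrite -(AK w); exact: chord_moves (moves_inv m) ch.
have dich w : strict_slope_cone f w ->
  strict_slope_cone g (A w) \/ strict_slope_cone g (- A w).
  by move=> /nch; exact: nchord_strict.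
apply: contrapT => /not_orP[/existsNP[w /not_implyP[hw nw]] /existsNP[w' /not_implyP[hw' nw']]].
have {nw}kw : strict_slope_cone g (- A w) by case: (dich w hw).
have {nw'}kw' : strict_slope_cone g (A w') by case: (dich w' hw').
pose ww s := A w' + s *: (A w - A w').
(* A unit step from the origin is enough: the sign differs at the two ends of the segment, and a
   zero exhibits a chord. *)
pose k s := g (ww s).1 - (g 0 + (ww s).2).
have ck : continuous k.
  move=> s; apply: cvgB.
    apply: (@continuous_comp R (R * R)%type R (fun s => (ww s).1) g); last exact: cg.
    by apply: cvgD; [exact: cvg_cst|apply: cvgZr_tmp; exact: cvg_id].
  apply: cvgD; first exact: cvg_cst.
  by apply: cvgD; [exact: cvg_cst|apply: cvgM; [exact: cvg_id|exact: cvg_cst]].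
have [||s s01 ks] := IVT01 ck.
- rewrite /k /ww scale0r addr0; have := kw' 1 0 ltr01.
  by rewrite scale1r add0r; lra.
- rewrite /k /ww scale1r (addrC (A w')) subrK; have := kw 1 (A w).1 ltr01.
  by rewrite scale1r /= subrr; lra.
have [oA _ _ _ _] := m.
apply: (nch (w' + s *: (w - w'))); first exact: strict_slope_cone_conv.
exists 1, 0; split => //; rewrite scale1r mul1r add0r (orthD oA) (orthZ oA) (orthB oA).
by apply/eqP; rewrite -subr_eq0; apply/eqP; exact: ks.
Qed.

(** The strict case passes to the whole cone by adding a small multiple of [e3] and using that the
    target cone is closed. *)
Lemma slope_cone_moves1 :
  (forall w, slope_cone f w -> slope_cone g (A w)) \/
  (forall w, slope_cone f w -> slope_cone g (- A w)).
Proof.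
have [oA _ _ _ _] := m.
have e0 (e : R) u : 0 < e -> exists2 d : R, 0 < d & `|d *: u| < e.
  move=> e0; exists (e / (`|u| + 1)); first by rewrite divr_gt0// ltr_wpDl.
  have u1 : 0 < `|u| + 1 by rewrite ltr_wpDl.
  rewrite normrZ gtr0_norm ?divr_gt0// mulrAC ltr_pdivrMr// ltr_pM2l//; lra.
case: strict_slope_cone_moves => h; [left|right] => w hw;
  apply: slope_cone_closed => // e ep; have [d d0 hd] := e0 e (A e3) ep.
  exists (A (w + d *: e3)); first exact/strict_slope_coneW/h/slope_cone_strict.
  by rewrite (orthD oA) (orthZ oA) addrC addKr.
exists (- A (w + d *: e3)); first exact/strict_slope_coneW/h/slope_cone_strict.
by rewrite (orthD oA) (orthZ oA) -opprD normrN addrAC subrr add0r.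
Qed.

End Moves.

(** [B] is [A] or its opposite. The signs obtained for [A] and [A'] must agree, since otherwise
    [- e3] would be a slope direction of [f]. *)
Lemma slope_cone_moves f g b A A' : continuous f -> continuous g -> moves f g b A A' ->
  exists B B', [/\ orth B, orth B', cancel B B', cancel B' B &
    forall w, slope_cone f w <-> slope_cone g (B w)] /\
    (A' e3 = B' e3 \/ A' e3 = - B' e3).
Proof.
move=> cf cg m; have [oA oA' AK KA _] := m.
have N := slope_cone_Ne3 (f := f).
have [h|h] := slope_cone_moves1 cg m;
  have [h'|h'] := slope_cone_moves1 cf (moves_inv m).
- exists A, A'; split; last by left.
  by split => // w; split=> [/h//|/h']; rewrite AK.
- by case: N; have := h' _ (h _ (slope_cone_e3 f)); rewrite AK.
- by case: N; have := h' _ (h _ (slope_cone_e3 f)); rewrite (orthN oA') AK.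
exists (fun u => - A u), (fun u => - A' u); split; last by right; rewrite opprK.
split; [exact: orth_opp|exact: orth_opp| | |].
- by move=> u; rewrite (orthN oA') AK opprK.
- by move=> u; rewrite (orthN oA) KA opprK.
- by move=> w; split=> [/h//|/h']; rewrite (orthN oA') AK opprK.
Qed.

Lemma slope_cone_scale f c w : 0 < c ->
  slope_cone (fun p => c * f p) w <-> slope_cone f (w.1, c^-1 * w.2).
Proof.
move=> c0; have e t p : c * f p + t * w.2 = c * (f p + t * (c^-1 * w.2)).
  by rewrite mulrDr (mulrCA c t) mulVKf// gt_eqF.
split=> h t p t0; have := h t p t0; rewrite /= e ler_pM2l//.
Qed.

End SlopeCone.

(** * Cones without lines *)

Section Pointed.
Context {R : realType}.
Variable f : R * R -> R.
Hypothesis cf : continuous f.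
Implicit Types (u v w : R * R * R).

Lemma dot_cluster_neq0 u w : dot u u = 1 -> `|u - w| < 1 / 4 -> w != 0.
Proof.
move=> u1; apply: contraTneq => ->; rewrite subr0 -leNgt.
have := dot_le_norm_sqr u; have := normr_ge0 u; rewrite u1; nra.
Qed.

(** Compactness: a cluster point of the unit vectors [u] is nonzero, and its opposite is approached
    by the vectors [u']. *)
Lemma slope_cone_line :
  (forall e, 0 < e -> exists u u', [/\ slope_cone f u, slope_cone f u', dot u u = 1 &
    `|u + u'| < e]) ->
  exists w, [/\ w != 0, slope_cone f w & slope_cone f (- w)].
Proof.
move=> h.
have [us hus] : exists us : nat -> R * R * R, forall n, exists u', [/\ slope_cone f (us n),
    slope_cone f u', dot (us n) (us n) = 1 & `|us n + u'| < n.+1%:R^-1].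
  have [us hus] := choice (fun n => h n.+1%:R^-1 (ltac:(by rewrite invr_gt0))).
  by exists us.
have [|l hl] := @cluster_seq R us 1.
  move=> n; have [u' [_ _ u1 _]] := hus n.
  by have := norm_sqr_le_dot (us n); have := normr_ge0 (us n); rewrite u1; nra.
have {}hl e : 0 < e -> exists u u', [/\ slope_cone f u, slope_cone f u', dot u u = 1,
    `|u + u'| < e & `|u - l| < e].
  move=> e0; have [n Nn ul] := hl e e0 (Num.bound e^-1).
  have [u' [h1 h2 h3 h4]] := hus n; exists (us n), u'; split=> //.
  apply: (lt_le_trans h4); rewrite invf_ple ?posrE//.
  apply/ltW/(lt_le_trans (archi_boundP _)); first by rewrite invr_ge0 ltW.
  by rewrite ler_nat; apply: leqW.
exists l; split.
- have [u [u' [_ _ u1 _ ul]]] := hl (1 / 4) (ltac:(lra)).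
  exact: dot_cluster_neq0 u1 ul.
- apply: slope_cone_closed => // e /hl[u [u' [hu _ _ _ ul]]].
  by exists u.
- apply: slope_cone_closed => // e e0.
  have [u [u' [_ hu' _ uu' ul]]] := hl (e / 2) (ltac:(lra)).
  exists u' => //; rewrite opprK.
  have -> : u' + l = (u + u') - (u - l) by apply: v3_eq; rewrite /=; ring.
  by apply: le_lt_trans (ler_normB _ _) _; lra.
Qed.

Variable C : set R.
Hypothesis C0 : forall c, C c -> 0 < c.
Hypothesis Cmov : forall c, C c -> exists b A A', moves f (fun p => c * f p) b A A'.
Hypothesis Cinf : forall r, exists2 c, C c & r < c.
Hypothesis ptd : forall w, slope_cone f w -> slope_cone f (- w) -> w = 0.

Lemma slope_cone_rigid c : C c ->
  exists b A A' B B', moves f (fun p => c * f p) b A A' /\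
    [/\ orth B, orth B', cancel B B', cancel B' B &
    forall w, slope_cone f w <-> slope_cone f ((B w).1, c^-1 * (B w).2)] /\
    (A' e3 = B' e3 \/ A' e3 = - B' e3).
Proof.
move=> Cc; have [b [A [A' m]]] := Cmov Cc.
have ccf : continuous (fun p => c * f p) by move=> p; apply: cvgM; [exact: cvg_cst|exact: cf].
have [B [B' [[oB oB' BK KB h] h']]] := slope_cone_moves cf ccf m.
exists b, A, A', B, B'; split => //; split => //; split => // w.
by rewrite h slope_cone_scale// C0.
Qed.

(* If [(v, -1)] were in the cone, then for large [c] the images under [B'] of [e3]
   and [(v / c, -1)] would be almost opposite. *)
Lemma pointed_slope_ge0 w : slope_cone f w -> 0 <= w.2.
Proof.
move=> hw; rewrite leNgt; apply/negP => w2.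
have [|l [l0 hl hNl]] := slope_cone_line; last by have := ptd hl hNl => /eqP;
  rewrite (negbTE l0).
move=> e e0.
have [v hv] : exists v : R * R, slope_cone f (v, -1).
  exists ((- w.2)^-1 *: w.1).
  have -> : ((- w.2)^-1 *: w.1, -1) = (- w.2)^-1 *: w.
    by apply: pair_eq => //=; rewrite scaleRE invrN mulNr mulVf// lt_eqF.
  by apply: slope_coneZ; rewrite // invr_ge0; lra.
pose d := dot (v, 0) (v, 0).
have d0 : 0 <= d by exact: dot_ge0.
(* The two images will add up to a vector of squared length [d / c ^+ 2]; [c > 1] and
   [d < c * e ^+ 2] make this less than [e ^+ 2]. *)
have [c Cc] := Cinf (1 + d / e ^+ 2); have c0 := C0 Cc => cd.
have c1 : 1 < c by apply: le_lt_trans cd; rewrite lerDl divr_ge0// sqr_ge0.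
have dc : d < c * e ^+ 2.
  rewrite -ltr_pdivrMr ?exprn_gt0//; lra.
have [b [A [A' [B [B' [_ [[oB oB' BK KB h] _]]]]]]] := slope_cone_rigid Cc.
exists (B' e3), (B' (c^-1 *: v, - 1)); split.
- rewrite h KB /=; have := slope_coneZ (_ : 0 <= c^-1) (slope_cone_e3 f).
  by rewrite invr_ge0 ltW// /= => /(_ isT); congr slope_cone; apply: v3_eq;
    rewrite /= ?scaleRE ?mulr0.
- rewrite h KB /=; have := slope_coneZ (_ : 0 <= c^-1) hv.
  by rewrite invr_ge0 ltW// => /(_ isT); congr slope_cone.
- by rewrite (orth_dot oB') /dot /=; ring.
rewrite -(orthD oB'); set z := (_ + _).
have := norm_sqr_le_dot (B' z); rewrite (orth_dot oB').
have -> : dot z z = d / c ^+ 2.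
  by rewrite /z /d /dot /= !scaleRE addrN; field; rewrite gt_eqF//.
have : d / c ^+ 2 < e ^+ 2.
  rewrite ltr_pdivrMr ?exprn_gt0//; apply: lt_trans dc _.
  rewrite mulrC ltr_pM2l ?exprn_gt0// expr2 ltr_pMr//; lra.
have := normr_ge0 (B' z); nra.
Qed.

(* [B] maps the cone into itself, so recurrence makes it onto: the cone is
   invariant under the vertical scaling by [c^-1]. *)
Lemma pointed_slope_horizontal w : slope_cone f w -> slope_cone f (w.1, 0).
Proof.
have [c Cc c1] := Cinf 1; have c0 := C0 Cc.
have [b [A [A' [B [B' [_ [[oB oB' BK KB h] _]]]]]]] := slope_cone_rigid Cc.
have ci1 : c^-1 < 1 by rewrite invf_lt1.
have ci0 : 0 < c^-1 by rewrite invr_gt0.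
have up u : slope_cone f (u.1, c^-1 * u.2) -> slope_cone f u.
  move=> hu; have := pointed_slope_ge0 hu; rewrite /= pmulr_rge0// => u2.
  have -> : u = (u.1, c^-1 * u.2) + (u.2 - c^-1 * u.2) *: e3.
    by apply: v3_eq; rewrite /= !scaleRE ?mulr0 ?addr0// mulr1 addrC subrK.
  apply: slope_coneD => //; apply: slope_coneZ; last exact: slope_cone_e3.
  by rewrite subr_ge0 ler_piMl// ltW.
have down u : slope_cone f u -> slope_cone f (u.1, c^-1 * u.2).
  move=> hu; rewrite -slope_cone_scale//.
  apply: slope_cone_closed.
    by move=> p; apply: cvgM; [exact: cvg_cst|exact: cf].
  move=> e e0.
  have hit n : slope_cone f (iter n B u) by elim: n => //= n /h/up.
  have bit n : `|iter n B u| <= 1 + dot u u.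
    have : dot (iter n B u) (iter n B u) = dot u u by elim: n => //= n <-;
      rewrite (orth_dot oB).
    have := norm_sqr_le_dot (iter n B u); have := normr_ge0 (iter n B u); have := dot_ge0 u.
    by move=> + + + E; rewrite E; nra.
  have isoB p q : dot (B p - B q) (B p - B q) = dot (p - q) (p - q).
    by rewrite -(orthB oB) (orth_dot oB).
  (* The return to [u] takes at least one application of [B], so the returning point lies in the
     stretched cone. *)
  have [k hk] := isometry_recurrent isoB bit e0.
  by exists (iter k.+1 B u) => //; rewrite slope_cone_scale//; exact: (h _).1 (hit k).
move=> hw; have hn n : slope_cone f (w.1, c^-1 ^+ n * w.2).
  elim: n => [|n IH]; first by rewrite mul1r -surjective_pairing.
  by rewrite exprS -mulrA; exact: (down _ IH).
apply: slope_cone_closed => // e e0.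
have : (fun n => c^-1 ^+ n * w.2) @ \oo --> 0 * w.2.
  by apply: cvgM; [apply: cvg_expr; rewrite ger0_norm// ltW|exact: cvg_cst].
rewrite mul0r => /cvgrPdist_lt /(_ e e0)[N _ /(_ N (leqnn N))] /= hN.
exists (w.1, c^-1 ^+ N * w.2) => //.
rewrite ltr_norm_pair /= subrr normr0 e0/=.
by rewrite -normrN opprB.
Qed.

(** * Extreme rays of a cone without lines *)

Definition extreme w := forall u v, slope_cone f u -> slope_cone f v -> w = u + v ->
  exists a, u = a *: w.

Definition flat_extreme w := [/\ w.2 = 0, dot w w = 1, slope_cone f w & extreme w].

(** [e3] is extreme in the stretched cone: two summands of it have opposite horizontal parts, both
    in the cone of [f], hence zero. Its image [B' e3] is thus extreme, and splitting that vector
    into vertical and horizontal parts, both in the cone, shows that one part vanishes. *)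
Lemma rigid_extreme c (B B' : R * R * R -> R * R * R) : 0 < c ->
  [/\ orth B, orth B', cancel B B', cancel B' B &
    forall w, slope_cone f w <-> slope_cone f ((B w).1, c^-1 * (B w).2)] ->
  B' e3 = e3 \/ flat_extreme (B' e3).
Proof.
move=> c0 [oB oB' BK KB h]; have ci0 : 0 < c^-1 by rewrite invr_gt0.
have d1 : dot (B' e3) (B' e3) = 1 by rewrite (orth_dot oB') /dot /=; ring.
have hu : slope_cone f (B' e3).
  rewrite h KB /=; have := slope_coneZ (ltW ci0) (slope_cone_e3 f).
  by congr slope_cone; apply: v3_eq; rewrite /= ?scaleRE ?mulr0.
have ext : extreme (B' e3).
  move=> w w' hw hw' E.
  have E' : e3 = B w + B w' by rewrite -(orthD oB) -E KB.
  have /pointed_slope_horizontal /= h1 : slope_cone f ((B w).1, c^-1 * (B w).2) by rewrite -h.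
  have /pointed_slope_horizontal /= h2 : slope_cone f ((B w').1, c^-1 * (B w').2)
    by rewrite -h.
  have e1 : (B w').1 = - (B w).1.
    by apply/eqP; rewrite eq_sym -subr_eq0 -opprD oppr_eq0; have /(congr1 fst)/= <- := E'.
  have : (((B w).1, 0) : R * R * R) = 0.
    apply: ptd => //; move: h2; rewrite e1; congr slope_cone.
    by apply: pair_eq; rewrite //= oppr0.
  move/(congr1 fst) => /= B0; exists (B w).2.
  rewrite -(orthZ oB') -[LHS]BK; congr B'.
  by apply: v3_eq; rewrite /= ?B0 ?scaleRE ?mulr0 ?mulr1.
set u := B' e3 in d1 hu ext *.
have hu0 := pointed_slope_horizontal hu; have u0 := pointed_slope_ge0 hu.
have hz : slope_cone f (u.2 *: e3) by apply: slope_coneZ => //; exact: slope_cone_e3.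
have uE : u = u.2 *: e3 + (u.1, 0).
  by apply: v3_eq; rewrite /= ?scaleRE ?mulr0 ?add0r// mulr1 addr0.
have [a ha] := ext _ _ hz hu0 uE.
have [u20|u20] := eqVneq u.2 0; first by right; split.
have a0 : a != 0.
  apply: contra_neq u20 => a0; have := congr1 snd ha.
  by rewrite a0 /= !scaleRE mulr1 mul0r.
have := congr1 (fun p => p.1.1) ha; have := congr1 (fun p => p.1.2) ha.
rewrite /= !scaleRE !mulr0 => /esym/eqP; rewrite mulf_eq0 (negbTE a0)/= => /eqP u12.
move=> /esym/eqP; rewrite mulf_eq0 (negbTE a0)/= => /eqP u11.
left; apply: v3_eq => //=; move: d1; rewrite /dot u11 u12; nra.
Qed.

Lemma flat_extreme_comb u v w a b c : flat_extreme u -> flat_extreme v -> flat_extreme w ->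
  0 < a -> 0 < b -> 0 <= c -> a *: u = b *: v + c *: w -> u = v.
Proof.
move=> [u2 uu hu eu] [v2 vv hv ev] [_ _ hw _] a0 b0 c0 E.
have [|||k hk] := eu ((b / a) *: v) ((c / a) *: w).
- by apply: slope_coneZ => //; rewrite divr_ge0// ltW.
- by apply: slope_coneZ => //; rewrite divr_ge0// ltW.
- apply: (scalerI (lt0r_neq0 a0)); rewrite E scalerDr !scalerA.
  by rewrite !(mulrCA a) !mulfV ?mulr1// gt_eqF.
pose m := (b / a)^-1 * k.
have vE : v = m *: u.
  apply: (scalerI (lt0r_neq0 (divr_gt0 b0 a0))); rewrite hk scalerA mulVKf//.
  by rewrite gt_eqF// divr_gt0.
have : (m - 1) * (m + 1) = 0.
  by move: vv; rewrite vE dotZ dotZr uu; lra.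
move/eqP; rewrite mulf_eq0 subr_eq0 addr_eq0 => /orP[]/eqP m1.
  by rewrite vE m1 scale1r.
have u0 : u = 0.
  apply: ptd => //; move: hv; by rewrite vE m1 scaleN1r.
by move: uu; rewrite u0 /dot /= !mul0r !addr0 => /esym/eqP; rewrite oner_eq0.
Qed.

(** Moving the negative terms to the other side writes one vector as a nonnegative combination of
    the others, so extremality applies; if all signs are positive, the cone contains a line. *)
Lemma flat_extreme_rel u v w a b c : flat_extreme u -> flat_extreme v -> flat_extreme w ->
  0 < a -> b != 0 -> c != 0 -> a *: u + b *: v + c *: w = 0 -> u = v \/ u = w.
Proof.
move=> hu hv hw a0; rewrite !neq_lt => /orP[]b0 /orP[]c0 E.
- left; apply: (flat_extreme_comb hu hv hw a0 (_ : 0 < - b) (_ : 0 <= - c));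
  rewrite ?oppr_gt0 ?oppr_ge0 ?(ltW c0)//.
  by rewrite !scaleNr; apply/eqP; rewrite -subr_eq0 opprD !opprK addrA E.
- left; symmetry; apply: (flat_extreme_comb hv hu hw (_ : 0 < - b) a0 (ltW c0));
  rewrite ?oppr_gt0//.
  by rewrite scaleNr; apply/eqP; rewrite eq_sym -subr_eq0 opprK addrAC E.
- right; symmetry; apply: (flat_extreme_comb hw hu hv (_ : 0 < - c) a0 (ltW b0));
  rewrite ?oppr_gt0//.
  by rewrite scaleNr; apply/eqP; rewrite eq_sym -subr_eq0 opprK E.
have [_ uu su _] := hu; have [_ _ sv _] := hv; have [_ _ sw _] := hw.
have u0 : a *: u = 0.
  apply: ptd; first by apply: slope_coneZ => //; exact: ltW.
  have -> : - (a *: u) = b *: v + c *: w.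
    by apply/eqP; rewrite -subr_eq0 -opprD oppr_eq0 addrA E.
  by apply: slope_coneD; apply: slope_coneZ => //; exact: ltW.
move/eqP: u0; rewrite scaler_eq0 gt_eqF//= => /eqP u0.
by move: uu; rewrite u0 /dot /= !mul0r !addr0 => /esym/eqP; rewrite oner_eq0.
Qed.

Lemma flat_extreme_det u v : flat_extreme u -> flat_extreme v ->
  u.1.1 * v.1.2 - u.1.2 * v.1.1 = 0 -> u = v.
Proof.
move=> hu hv d0; have [u2 uu su _] := hu; have [v2 vv sv _] := hv.
have e0 : 0 * 0 = 0 :> R by rewrite mul0r.
move: uu vv; rewrite /dot u2 v2 e0 !addr0 => uu vv.
pose k := u.1.1 * v.1.1 + u.1.2 * v.1.2.
have e1 : v.1.1 = k * u.1.1.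
  transitivity (v.1.1 * (u.1.1 * u.1.1 + u.1.2 * u.1.2)); first by rewrite uu mulr1.
  transitivity (k * u.1.1 - u.1.2 * (u.1.1 * v.1.2 - u.1.2 * v.1.1)); first by rewrite /k;
    ring.
  by rewrite d0 mulr0 subr0.
have e2 : v.1.2 = k * u.1.2.
  transitivity (v.1.2 * (u.1.1 * u.1.1 + u.1.2 * u.1.2)); first by rewrite uu mulr1.
  transitivity (k * u.1.2 + u.1.1 * (u.1.1 * v.1.2 - u.1.2 * v.1.1)); first by rewrite /k;
    ring.
  by rewrite d0 mulr0 addr0.
have vE : v = k *: u by apply: v3_eq => //=; rewrite u2 v2 scaler0.
have [k0|k0|k0] := ltgtP k 0.
- have u0 : u = 0.
    apply: ptd => //; have -> : - u = (- k)^-1 *: v.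
      by rewrite vE scalerA invrN mulNr mulVf ?lt_eqF// scaleN1r.
    by apply: slope_coneZ => //; rewrite invr_ge0; lra.
  by move: uu; rewrite u0 /= !mul0r addr0 => /esym/eqP; rewrite oner_eq0.
- symmetry; apply: (flat_extreme_comb hv hu hu ltr01 k0 (lexx 0)).
  by rewrite scale0r addr0 scale1r.
by move: vv; rewrite vE k0 scale0r /= !mul0r addr0 => /esym/eqP; rewrite oner_eq0.
Qed.

Lemma flat_extreme3 u v w : flat_extreme u -> flat_extreme v -> flat_extreme w ->
  [\/ u = v, u = w | v = w].
Proof.
move=> hu hv hw.
(* The 2x2 minors are the coefficients of the linear relation between three vectors of the
   horizontal plane. *)
pose a := v.1.1 * w.1.2 - v.1.2 * w.1.1.
pose b := w.1.1 * u.1.2 - w.1.2 * u.1.1.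
pose c := u.1.1 * v.1.2 - u.1.2 * v.1.1.
have [a0|a0] := eqVneq a 0; first by apply: Or33; exact: flat_extreme_det.
have [b0|b0] := eqVneq b 0; first by apply: Or32; symmetry; exact: flat_extreme_det.
have [c0|c0] := eqVneq c 0; first by apply: Or31; exact: flat_extreme_det.
have E : a *: u + b *: v + c *: w = 0.
  have [u2 _ _ _] := hu; have [v2 _ _ _] := hv; have [w2 _ _ _] := hw.
  by apply: v3_eq; rewrite /= !scaleRE ?u2 ?v2 ?w2 /a /b /c; ring.
move: a0; rewrite neq_lt => /orP[] a0.
  have [||||h|h] := @flat_extreme_rel u v w (- a) (- b) (- c) hu hv hw.
  - by rewrite oppr_gt0.
  - by rewrite oppr_eq0.
  - by rewrite oppr_eq0.
  - by rewrite !scaleNr -!opprD E oppr0.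
  - exact: Or31.
  - exact: Or32.
by have [h|h] := flat_extreme_rel hu hv hw a0 b0 c0 E; [exact: Or31|exact: Or32].
Qed.

Lemma flat_extreme_two : exists u v, flat_extreme `<=` [set u; v].
Proof.
have [[u hu]|no] := pselect (exists u, flat_extreme u); last first.
  by exists 0, 0 => w hw; case: no; exists w.
have [[v hv uv]|no] := pselect (exists2 v, flat_extreme v & u <> v); last first.
  by exists u, u => w hw; left; apply: contrapT => h; apply: no; exists w => // e; apply: h.
exists u, v => w hw; have [//|e|e] := flat_extreme3 hu hv hw; [by left|by right].
Qed.

Lemma exp_along_pointed : ~ countable C -> exp_along f.
Proof.
move=> nC; have [u [v huv]] := flat_extreme_two.
have nf : exists q0 q1, f q0 != f q1.
  apply: contrapT => no.
  have cst p q : f p = f q.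
    by apply/eqP/negPn/negP => h; apply: no; exists p, q.
  have : ((1, 0, 0) : R * R * R) = 0.
    by apply: ptd => t p _; rewrite (cst _ p) /= ?oppr0 mulr0 addr0.
  by move/(congr1 (fun w => w.1.1))/eqP; rewrite /= oner_eq0.
pose S := [set e3] `|` [set u; v].
have fS : finite_set S by rewrite /S !finite_setU; do !split; exact: finite_set1.
(* [A' e3] agrees with [B' e3] only up to sign, so opposites are added to the candidates. *)
apply: (exp_along_moves (E := S `|` [set - w | w in S]) cf nf nC C0).
  by apply: finite_set_countable; rewrite finite_setU; split => //; exact: finite_image.
move=> c Cc.
have [b [A [A' [B [B' [m [hB hA]]]]]]] := slope_cone_rigid Cc.
exists b, A, A'; split => //.
have hS : S (B' e3).
  have [->|/huv h] := rigid_extreme (C0 Cc) hB; first by left.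
  by right.
by case: hA => ->; [left|right; exists (B' e3)].
Qed.

End Pointed.

(** * Ridge surfaces *)

Section Ridge.
Context {R : realType}.
Implicit Types (f : R * R -> R) (u v w : R * R * R).

Lemma slope_cone_lineality f w : slope_cone f w -> slope_cone f (- w) ->
  forall t p, f (p + t *: w.1) = f p + t * w.2.
Proof.
move=> h h'.
have pos t p : 0 <= t -> f (p + t *: w.1) = f p + t * w.2.
  move=> t0; apply/eqP; rewrite eq_le h//=.
  by have := h' t (p + t *: w.1) t0; rewrite /= scalerN addrK; lra.
move=> t p; have [/pos//|t0] := leP 0 t.
have := pos (- t) (p + t *: w.1) (ltac:(lra)).
by rewrite scaleNr addrK; lra.
Qed.

Variable f : R * R -> R.
Hypothesis cf : continuous f.
Hypothesis fy : forall x y, f (x, y) = f (x, 0).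
Hypothesis naff : ~ exists a b, forall x, f (x, 0) = a + b * x.

Lemma ridge_eq p q : p.1 = q.1 -> f p = f q.
Proof. by case: p q => [? ?] [? ?] /= ->; rewrite fy [RHS]fy. Qed.

Lemma ridge_slope_cone x y y' z : slope_cone f (x, y, z) -> slope_cone f (x, y', z).
Proof.
by move=> h t p t0; have := h t p t0; rewrite (ridge_eq (q := p + t *: (x, y', z).1)).
Qed.

(** A line with a nonzero x-component would make the profile [x |-> f (x, 0)] affine. *)
Lemma ridge_lineality w : slope_cone f w -> slope_cone f (- w) -> w.1.1 = 0 /\ w.2 = 0.
Proof.
move=> h h'; have L := slope_cone_lineality h h'.
have w1 : w.1.1 = 0.
  apply: contra_notP naff => /eqP w0; exists (f 0), (w.2 / w.1.1) => x.
  have := L (x / w.1.1) 0;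
    rewrite add0r [(x / _) *: _]surjective_pairing fy /= scaleRE divfK//.
  by move=> ->; ring.
split => //; have := L 1 0; rewrite add0r scale1r mul1r [w.1]surjective_pairing w1 fy.
by rewrite -[(0, 0)]/(0 : R * R); lra.
Qed.

(** The determinant of the projections to the xz-plane. *)
Definition cross u v := u.1.1 * v.2 - v.1.1 * u.2.

Definition spans r1 r2 w := exists a b, [/\ 0 <= a, 0 <= b & w = a *: r1 + b *: r2].

Lemma spansD r1 r2 u v : spans r1 r2 u -> spans r1 r2 v -> spans r1 r2 (u + v).
Proof.
move=> [a [b [a0 b0 ->]]] [a' [b' [a0' b0' ->]]]; exists (a + a'), (b + b').
by split; rewrite ?addr_ge0// !scalerDl addrACA.
Qed.

Lemma spansZ r1 r2 a u : 0 <= a -> spans r1 r2 u -> spans r1 r2 (a *: u).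
Proof.
move=> a0 [b [c [b0 c0 ->]]]; exists (a * b), (a * c).
by split; rewrite ?mulr_ge0// scalerDr !scalerA.
Qed.

Lemma ridge_min_slope (s : R) : (exists z, slope_cone f (s, 0, z)) ->
  exists a, slope_cone f (s, 0, a) /\ forall z, slope_cone f (s, 0, z) -> a <= z.
Proof.
move=> ex; pose S := [set z | slope_cone f (s, 0, z)].
have iS : has_inf S.
  split => //; exists (f (s, 0) - f 0) => z /(_ 1 0 ler01) /=.
  by rewrite scale1r add0r mul1r; lra.
exists (inf S); split=> [|z hz]; last exact: (ge_inf iS.2).
apply: slope_cone_closed => // e e0.
have [z hz zi] := inf_adherent e0 iS.
exists (s, 0, z) => //.
rewrite ltr_norm_pair /= subrr normr0 e0 /= ger0_norm ?subr_ge0; first by lra.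
exact: (ge_inf iS.2).
Qed.

(** In the slice y = 0, the generator on each side is the direction of horizontal part 1 or -1 with
    the least slope, or [e3] if that side is empty; with both sides empty, only the vertical ray
    remains. *)
Lemma ridge_spans :
  (forall w, slope_cone f w -> w.1.2 = 0 -> exists2 a, 0 <= a & w = a *: e3) \/
  (exists r1 r2, [/\ slope_cone f r1, slope_cone f r2, r1.1.2 = 0, r2.1.2 = 0 &
    cross r1 r2 != 0] /\
     forall w, slope_cone f w -> w.1.2 = 0 -> spans r1 r2 w).
Proof.
have vert z : slope_cone f (0, 0, z) -> 0 <= z.
  by move=> /(_ 1 0 ler01) /=; rewrite -[(0, 0)]/(0 : R * R) scaler0 addr0; lra.
have scale (s : R) w : 0 < s -> slope_cone f w -> w.1.2 = 0 ->
    slope_cone f (s^-1 * w.1.1, 0, s^-1 * w.2).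
  move=> s0 hw w0; have := slope_coneZ (_ : 0 <= s^-1) hw.
  rewrite invr_ge0 ltW// => /(_ isT); congr slope_cone.
  by apply: v3_eq; rewrite /= !scaleRE ?w0 ?mulr0.
have right w : slope_cone f w -> w.1.2 = 0 -> 0 < w.1.1 -> slope_cone f (1, 0, w.1.1^-1 * w.2).
  by move=> hw w0 wp; have := scale _ _ wp hw w0; rewrite mulVf// gt_eqF.
have left w : slope_cone f w -> w.1.2 = 0 -> w.1.1 < 0 ->
  slope_cone f (-1, 0, (- w.1.1)^-1 * w.2).
  move=> hw w0 wn; have np : 0 < - w.1.1 by lra.
  by have := scale _ _ np hw w0; rewrite invrN mulNr mulVf// lt_eqF.
have zero w : slope_cone f w -> w.1.2 = 0 -> w.1.1 = 0 -> 0 <= w.2 /\ w = w.2 *: e3.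
  move=> hw w0 w1; split.
    by apply: vert; move: hw; rewrite [w]surjective_pairing [w.1]surjective_pairing w0 w1.
  by apply: v3_eq; rewrite /= !scaleRE ?w0 ?w1; ring.
have rightE a w : slope_cone f (1, 0, a) -> (forall z, slope_cone f (1, 0, z) -> a <= z) ->
    slope_cone f w -> w.1.2 = 0 -> 0 < w.1.1 ->
    exists2 k, 0 <= k & w = w.1.1 *: (1, 0, a) + k *: e3.
  move=> ha amin hw w0 wp; have := amin _ (right _ hw w0 wp).
  rewrite mulrC ler_pdivlMr// => h; exists (w.2 - a * w.1.1); first by lra.
  by apply: v3_eq; rewrite /= !scaleRE ?w0; ring.
have leftE a w : slope_cone f (-1, 0, a) -> (forall z, slope_cone f (-1, 0, z) -> a <= z) ->
    slope_cone f w -> w.1.2 = 0 -> w.1.1 < 0 ->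
    exists2 k, 0 <= k & w = (- w.1.1) *: (-1, 0, a) + k *: e3.
  move=> ha amin hw w0 wn; have := amin _ (left _ hw w0 wn).
  rewrite mulrC ler_pdivlMr; last by lra.
  move=> h; exists (w.2 + a * w.1.1); first by lra.
  by apply: v3_eq; rewrite /= !scaleRE ?w0; ring.
have [/ridge_min_slope[a [ha amin]]|nor] := pselect (exists z, slope_cone f (1, 0, z));
have [/ridge_min_slope[b [hb bmin]]|nol] := pselect (exists z, slope_cone f (-1, 0, z)).
- right; exists (1, 0, a), (-1, 0, b).
  have ab : 0 < a + b.
    rewrite lt_neqAle; apply/andP; split.
      apply/eqP => ab0.
      have e : - ((1, 0, a) : R * R * R) = (-1, 0, b) by apply: v3_eq; rewrite /= ?oppr0//;
        lra.
      have [||/eqP] := @ridge_lineality (1, 0, a); rewrite ?e//.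
      by rewrite /= oner_eq0.
    apply: vert; have := slope_coneD ha hb; congr slope_cone.
    by apply: v3_eq; rewrite /=; ring.
  split; first by split => //; rewrite /cross /= gt_eqF//; lra.
  have s1 : spans (1, 0, a) (-1, 0, b) (1, 0, a).
    by exists 1, 0; split; rewrite ?ler01// scale0r scale1r addr0.
  have s2 : spans (1, 0, a) (-1, 0, b) (-1, 0, b).
    by exists 0, 1; split; rewrite ?ler01// scale0r scale1r add0r.
  have s3 : spans (1, 0, a) (-1, 0, b) e3.
    exists (a + b)^-1, (a + b)^-1; split; rewrite ?invr_ge0 ?ltW//.
    by apply: v3_eq; rewrite /= !scaleRE; field; rewrite gt_eqF.
  move=> w hw w0; have [wn|wp|w1] := ltgtP w.1.1 0.
  + have [k k0 ->] := leftE _ _ hb bmin hw w0 wn.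
    by apply: spansD; apply: spansZ => //; lra.
  + have [k k0 ->] := rightE _ _ ha amin hw w0 wp.
    by apply: spansD; apply: spansZ => //; exact: ltW.
  + by have [k0 ->] := zero _ hw w0 w1; exact: spansZ.
- right; exists (1, 0, a), e3; split.
    by split => //; [exact: slope_cone_e3|rewrite /cross /=; apply/eqP; lra].
  move=> w hw w0; have [wn|wp|w1] := ltgtP w.1.1 0.
  + by case: nol; exists ((- w.1.1)^-1 * w.2); exact: left.
  + have [k k0 e] := rightE _ _ ha amin hw w0 wp.
    by exists w.1.1, k; split => //; exact: ltW.
  + have [k0 e] := zero _ hw w0 w1; exists 0, w.2; split => //.
    by rewrite scale0r add0r.
- right; exists e3, (-1, 0, b); split.
    by split => //; [exact: slope_cone_e3|rewrite /cross /=; apply/eqP; lra].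
  move=> w hw w0; have [wn|wp|w1] := ltgtP w.1.1 0.
  + have [k k0 e] := leftE _ _ hb bmin hw w0 wn.
    by exists k, (- w.1.1); split => //; [lra|rewrite addrC].
  + by case: nor; exists (w.1.1^-1 * w.2); exact: right.
  + have [k0 e] := zero _ hw w0 w1; exists w.2, 0; split => //.
    by rewrite scale0r addr0.
left=> w hw w0; have [wn|wp|w1] := ltgtP w.1.1 0.
- by case: nol; exists ((- w.1.1)^-1 * w.2); exact: left.
- by case: nor; exists (w.1.1^-1 * w.2); exact: right.
- by have [k0 e] := zero _ hw w0 w1; exists w.2.
Qed.

(** * Motions acting on the cone of a ridge surface *)

Variable C : set R.
Hypothesis C0 : forall c, C c -> 0 < c.
Hypothesis Cmov : forall c, C c -> exists b A A', moves f (fun p => c * f p) b A A'.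
Hypothesis nC : ~ countable C.

(** The y-axis is the only line in the cone and in the stretched one, so [B] preserves it and hence
    its orthogonal complement. *)
Lemma ridge_rigid_plane c (B B' : R * R * R -> R * R * R) : 0 < c ->
  [/\ orth B, orth B', cancel B B', cancel B' B &
    forall w, slope_cone f w <-> slope_cone f ((B w).1, c^-1 * (B w).2)] ->
  (forall w, w.1.2 = 0 -> (B w).1.2 = 0) /\ (forall w, w.1.2 = 0 -> (B' w).1.2 = 0).
Proof.
move=> c0 [oB oB' BK KB h]; have ci : c^-1 != 0 by rewrite invr_eq0 gt_eqF.
pose e2 : R * R * R := (0, 1, 0).
have he2 : slope_cone f e2 /\ slope_cone f (- e2).
  by split; apply: (@ridge_slope_cone _ 0) => t p _;
    rewrite /= ?oppr0 scaler0 addr0 mulr0 addr0.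
have [B1 B2] : (B e2).1.1 = 0 /\ c^-1 * (B e2).2 = 0.
  apply: (ridge_lineality (w := ((B e2).1, c^-1 * (B e2).2))); first exact: (h e2).1 he2.1.
  have := (h (- e2)).1 he2.2; rewrite (orthN oB); congr slope_cone.
  by apply: pair_eq; rewrite //= mulrN.
have {}B2 : (B e2).2 = 0 by move/eqP: B2; rewrite mulf_eq0 (negbTE ci) => /eqP.
have By : (B e2).1.2 * (B e2).1.2 = 1.
  have := orth_dot oB e2 e2; rewrite /dot B1 B2 /=; lra.
have By0 : (B e2).1.2 != 0.
  by apply/eqP => e; move: By; rewrite e mul0r => /eqP; rewrite eq_sym oner_eq0.
have dB w : dot (B w) (B e2) = (B w).1.2 * (B e2).1.2.
  by rewrite /dot B1 B2 !mulr0 addr0 add0r.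
split=> w w0.
  have := dB w; rewrite (orth_dot oB) /dot w0 /= !mulr0 mul0r !addr0 => /esym/eqP.
  by rewrite mulf_eq0 (negbTE By0) orbF => /eqP.
have := dB (B' w); rewrite (orth_dot oB) KB w0 mul0r /dot /= => e; lra.
Qed.

(* A nonnegative invertible 2x2 matrix whose inverse is nonnegative is monomial,
   so [B'] permutes the two extreme rays up to scaling. *)
Lemma ridge_rays c r1 r2 (B B' : R * R * R -> R * R * R) : 0 < c ->
  [/\ orth B, orth B', cancel B B', cancel B' B &
    forall w, slope_cone f w <-> slope_cone f ((B w).1, c^-1 * (B w).2)] ->
  [/\ slope_cone f r1, slope_cone f r2, r1.1.2 = 0, r2.1.2 = 0 & cross r1 r2 != 0] ->
  (forall w, slope_cone f w -> w.1.2 = 0 -> spans r1 r2 w) ->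
  exists k l, (B' (r1.1, c * r1.2) = k *: r1 /\ B' (r2.1, c * r2.2) = l *: r2) \/
              (B' (r1.1, c * r1.2) = k *: r2 /\ B' (r2.1, c * r2.2) = l *: r1).
Proof.
move=> c0 hB [h1 h2 y1 y2 cr] sp.
have [Bp Bp'] := ridge_rigid_plane c0 hB; have [oB oB' BK KB h] := hB.
have cn : c != 0 by rewrite gt_eqF.
set s1 := (r1.1, _); set s2 := (r2.1, _).
have u_sp r : slope_cone f r -> r.1.2 = 0 -> spans r1 r2 (B' (r.1, c * r.2)).
  move=> hr yr; apply: sp; last exact: Bp'.
  by rewrite h KB /= mulKf// -surjective_pairing.
have [a11 [a12 [a11p a12p e1]]] := u_sp _ h1 y1.
have [a21 [a22 [a21p a22p e2]]] := u_sp _ h2 y2.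
(* Conversely, [B] sends each generator into the stretched cone, so the generators are nonnegative
   combinations of [B' s1] and [B' s2]; the coefficients [b] will form the inverse of the matrix of
   the [a]. *)
have r_sp r : slope_cone f r -> r.1.2 = 0 -> spans (B' s1) (B' s2) r.
  move=> hr yr; have /h/sp := hr; rewrite Bp// => /(_ erefl)[a [b [a0 b0 e]]].
  exists a, b; split => //; rewrite -(orthZ oB' a) -(orthZ oB' b) -(orthD oB') -[LHS]BK;
    congr B'.
  have := congr1 fst e => /= e11.
  apply: pair_eq => //=.
  have := congr1 snd e => /=; rewrite !scaleRE => e12.
  transitivity (c * (c^-1 * (B r).2)); first by rewrite mulVKf.
  by rewrite e12; ring.
have [b11 [b12 [b11p b12p f1]]] := r_sp _ h1 y1.
have [b21 [b22 [b21p b22p f2]]] := r_sp _ h2 y2.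
rewrite -/s1 in e1; rewrite -/s2 in e2.
have indep a b : a *: r1 + b *: r2 = 0 -> a = 0 /\ b = 0.
  move=> e; have := congr1 (fun w => w.1.1) e; have := congr1 snd e;
    rewrite /= !scaleRE => E2 E1.
  split; apply: (mulIf cr); rewrite mul0r /cross.
    transitivity (r2.2 * (a * r1.1.1 + b * r2.1.1) - r2.1.1 * (a * r1.2 + b * r2.2));
      first by ring.
    by rewrite E1 E2 !mulr0 subr0.
  transitivity (r1.1.1 * (a * r1.2 + b * r2.2) - r1.2 * (a * r1.1.1 + b * r2.1.1));
    first by ring.
  by rewrite E1 E2 !mulr0 subr0.
have [E1 E2] : b11 * a11 + b12 * a21 - 1 = 0 /\ b11 * a12 + b12 * a22 = 0.
  apply: indep; apply/eqP; rewrite -subr_eq0 subr0; apply/eqP.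
  transitivity (b11 *: (a11 *: r1 + a12 *: r2) + b12 *: (a21 *: r1 + a22 *: r2) - r1).
    by apply: v3_eq; rewrite /= !scaleRE; ring.
  by rewrite -e1 -e2 -f1 subrr.
have [E3 E4] : b21 * a11 + b22 * a21 = 0 /\ b21 * a12 + b22 * a22 - 1 = 0.
  apply: indep; apply/eqP; rewrite -subr_eq0 subr0; apply/eqP.
  transitivity (b21 *: (a11 *: r1 + a12 *: r2) + b22 *: (a21 *: r1 + a22 *: r2) - r2).
    by apply: v3_eq; rewrite /= !scaleRE; ring.
  by rewrite -e1 -e2 -f2 subrr.
have split0 a b a' b' : 0 <= a -> 0 <= b -> 0 <= a' -> 0 <= b' -> a * b + a' * b' = 0 :> R ->
    a * b = 0 /\ a' * b' = 0.
  move=> pa pb pa' pb'; have := mulr_ge0 pa pb; have := mulr_ge0 pa' pb'; lra.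
have [Z1 Z2] := split0 _ _ _ _ b11p a12p b12p a22p E2.
have [Z3 Z4] := split0 _ _ _ _ b21p a11p b22p a21p E3.
have z (a b : R) : a * b = 0 -> a != 0 -> b = 0.
  by move=> /eqP + an; rewrite mulf_eq0 (negbTE an) => /eqP.
rewrite e1 e2; have [b110|b110] := eqVneq b11 0.
  have n12 : b12 != 0 by apply/eqP => e; move: E1; rewrite b110 e; lra.
  have a220 := z _ _ Z2 n12.
  have n21 : b21 != 0 by apply/eqP => e; move: E4; rewrite e a220; lra.
  have a110 := z _ _ Z3 n21.
  exists a12, a21; right.
  by rewrite a110 a220 !scale0r add0r addr0.
have a120 := z _ _ Z1 b110.
have n22 : b22 != 0 by apply/eqP => e; move: E4; rewrite e a120; lra.
have a210 := z _ _ Z4 n22.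
exists a11, a22; left.
by rewrite a120 a210 !scale0r add0r addr0.
Qed.

(* Equality of the angles at [B' s1, B' s2] and [s1, s2] reads
   (x1 x2 + c^2 z1 z2)^2 |r1|^2 |r2|^2 = (x1 x2 + z1 z2)^2 |s1|^2 |s2|^2,
   and the difference of the two sides factors as stated. *)
Lemma ridge_angle c r1 r2 (B' : R * R * R -> R * R * R) k l : orth B' ->
  r1.1.2 = 0 -> r2.1.2 = 0 -> cross r1 r2 != 0 ->
  (B' (r1.1, c * r1.2) = k *: r1 /\ B' (r2.1, c * r2.2) = l *: r2) \/
  (B' (r1.1, c * r1.2) = k *: r2 /\ B' (r2.1, c * r2.2) = l *: r1) ->
  c ^+ 2 = 1 \/ (r1.2 * r2.2) ^+ 2 * c ^+ 2 = (r1.1.1 * r2.1.1) ^+ 2.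
Proof.
move=> oB' y1 y2 cr h.
pose s1 : R * R * R := (r1.1, c * r1.2); pose s2 : R * R * R := (r2.1, c * r2.2).
have ang : dot s1 s2 ^+ 2 * dot r1 r1 * dot r2 r2 = dot r1 r2 ^+ 2 * dot s1 s1 * dot s2 s2.
  rewrite -!(orth_dot oB' s1) -(orth_dot oB' s2).
  by case: h => -[-> ->]; rewrite !dotZ !dotZr ?(dotC r2 r1); ring.
have : (cross r1 r2) ^+ 2 * ((c ^+ 2 - 1) *
   ((r1.2 * r2.2) ^+ 2 * c ^+ 2 - (r1.1.1 * r2.1.1) ^+ 2)) = 0.
  transitivity (dot s1 s2 ^+ 2 * dot r1 r1 * dot r2 r2 - dot r1 r2 ^+ 2 * dot s1 s1 * dot s2 s2).
    by rewrite /dot /cross /= y1 y2; ring.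
  by rewrite ang subrr.
move/eqP; rewrite !mulf_eq0 (negbTE cr) /= !subr_eq0.
by move=> /orP[]/eqP; [left|right].
Qed.

Lemma exp_along_ridge : exp_along f.
Proof.
have nf : exists q0 q1, f q0 != f q1.
  apply: contrapT => no; apply: naff; exists (f 0), 0 => x.
  rewrite mul0r addr0; apply/eqP/negPn/negP => h; apply: no.
  by exists (x, 0), 0.
have rig c : C c -> exists b A A' B B', moves f (fun p => c * f p) b A A' /\
    [/\ orth B, orth B', cancel B B', cancel B' B &
    forall w, slope_cone f w <-> slope_cone f ((B w).1, c^-1 * (B w).2)] /\
    (A' e3 = B' e3 \/ A' e3 = - B' e3) by exact: (slope_cone_rigid cf C0 Cmov).
have fin (S : set (R * R * R)) : finite_set S ->
    (forall c (B B' : R * R * R -> R * R * R), C c ->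
      [/\ orth B, orth B', cancel B B', cancel B' B &
      forall w, slope_cone f w <-> slope_cone f ((B w).1, c^-1 * (B w).2)] -> S (B' e3)) ->
    exp_along f.
  move=> fS hS.
  apply: (exp_along_moves (E := S `|` [set - w | w in S]) cf nf nC C0).
    by apply: finite_set_countable; rewrite finite_setU; split => //; exact: finite_image.
  move=> c Cc; have [b [A [A' [B [B' [m [hB hA]]]]]]] := rig c Cc.
  exists b, A, A'; split => //.
  have h := hS c B B' Cc hB.
  by case: hA => ->; [left|right; exists (B' e3)].
have unit (B' : R * R * R -> R * R * R) : orth B' -> dot (B' e3) (B' e3) = 1.
  by move=> oB'; rewrite (orth_dot oB') /dot /=; ring.
have [ray|[r1 [r2 [hr sp]]]] := ridge_spans.
  apply: (fin [set e3]); first exact: finite_set1.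
  move=> c B B' /C0 c0 hB; have [oB oB' BK KB h] := hB.
  have [_ yB'] := ridge_rigid_plane c0 hB.
  have [||a a0 e] := ray (B' e3); last 2 first.
  - exact: yB'.
  - have a1 : a * a = 1 by have := unit _ oB'; rewrite e dotZ dotZr /dot /=; lra.
    rewrite /= e; have -> : a = 1 by nra.
    exact: scale1r.
  rewrite h KB /=; have := slope_coneZ (_ : 0 <= c^-1) (slope_cone_e3 f).
  rewrite invr_ge0 ltW// => /(_ isT); congr slope_cone.
  by apply: v3_eq; rewrite /= ?scaleRE ?mulr0.
have [s1 s2 y1 y2 cr] := hr.
have ang c : C c -> c != 1 -> (r1.2 * r2.2) ^+ 2 * c ^+ 2 = (r1.1.1 * r2.1.1) ^+ 2.
  move=> Cc c1; have [b [A [A' [B [B' [m [hB hA]]]]]]] := rig c Cc.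
  have [k [l hkl]] := ridge_rays (C0 Cc) hB hr sp.
  have [_ oB' _ _ _] := hB.
  have [/eqP|//] := ridge_angle oB' y1 y2 cr hkl.
  rewrite sqrf_eq1 (negbTE c1) /= => /eqP e; have := C0 Cc; rewrite e; lra.
(* The identity [ang] is linear in [c ^+ 2] and holds for two values of it, so both coefficients
   vanish: as [cross r1 r2] is nonzero, one generator is vertical and the other horizontal. *)
have [z0 x0] : r1.2 * r2.2 = 0 /\ r1.1.1 * r2.1.1 = 0.
  have nC1 : ~ countable (C `\ 1).
    apply: contra_not nC => h; apply: (@sub_countable _ _ _ ((C `\ 1) `|` [set 1])).
      by apply: subset_card_le => c Cc; have [->|/eqP] := eqVneq c 1; [right|left].
    rewrite -bigcup2E; apply: bigcup_countable => // -[|[|n]] _ /=.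
    - exact: h.
    - exact/finite_set_countable/finite_set1.
    - exact: countable0.
  have [c [Cc c1] _] := uncountable_neq 1 nC1.
  have [d [Cd d1] dc] := uncountable_neq c nC1.
  have ec := ang c Cc (introN eqP c1); have ed := ang d Cd (introN eqP d1).
  have : (r1.2 * r2.2) ^+ 2 * (c ^+ 2 - d ^+ 2) = 0 by rewrite mulrBr ec ed subrr.
  have cd : c ^+ 2 - d ^+ 2 != 0.
    rewrite subr_eq0 eqrXn2 ?ltW ?C0//; apply/eqP => e; exact: dc.
  move/eqP; rewrite mulf_eq0 (negbTE cd) orbF => z0.
  move: ec; rewrite (eqP z0) mul0r => /esym/eqP; rewrite !sqrf_eq0 => /eqP ->.
  by move: z0; rewrite sqrf_eq0 => /eqP ->.
pose n (r : R * R * R) := (Num.sqrt (dot r r))^-1 *: r.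
pose S := [set n r1; - n r1] `|` [set n r2; - n r2].
apply: (fin S).
  by rewrite /S !finite_setU; do !split; exact: finite_set1.
move=> c B B' Cc hB; have c0 := C0 Cc.
have [k [l hkl]] := ridge_rays c0 hB hr sp; have [_ oB' _ _ _] := hB.
have mult : exists a, B' e3 = a *: r1 \/ B' e3 = a *: r2.
  (* Stretching keeps the vertical generator parallel to [e3], so [ridge_rays] places [B' e3] on the
     line of [r1] or of [r2]. *)
  have ax (r : R * R * R) : r.1.1 = 0 -> r.1.2 = 0 -> r.2 != 0 ->
    B' e3 = (c * r.2)^-1 *: B' (r.1, c * r.2).
    move=> e1 e2 e; rewrite -(orthZ oB'); congr B'; apply: v3_eq;
      rewrite /= !scaleRE ?e1 ?e2 ?mulr0//.
    by rewrite mulVf// mulf_neq0// gt_eqF.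
  move: x0 => /eqP; rewrite mulf_eq0 => /orP[]/eqP x0.
    have z1 : r1.2 != 0 by apply: contra_neq cr => z1; rewrite /cross x0 z1; ring.
    rewrite (ax r1)//; case: hkl => -[-> _]; exists ((c * r1.2)^-1 * k); rewrite scalerA;
      [by left|by right].
  have z2 : r2.2 != 0 by apply: contra_neq cr => z2; rewrite /cross x0 z2; ring.
  rewrite (ax r2)//; case: hkl => -[_ ->]; exists ((c * r2.2)^-1 * l); rewrite scalerA;
    [by right|by left].
have norm a r : B' e3 = a *: r -> B' e3 = n r \/ B' e3 = - n r.
  move=> e; have := unit _ oB'; rewrite e dotZ dotZr mulrA -expr2 => e1.
  have d0 : 0 < dot r r.
    rewrite lt_neqAle dot_ge0 andbT eq_sym; apply/eqP => d0.
    by move: e1; rewrite d0 mulr0 => /eqP; rewrite eq_sym oner_eq0.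
  have sq : Num.sqrt (dot r r) != 0 by rewrite sqrtr_eq0 -ltNge.
  have : (a - (Num.sqrt (dot r r))^-1) * (a + (Num.sqrt (dot r r))^-1) = 0.
    rewrite -subr_sqr exprVn sqr_sqrtr ?ltW//; apply/eqP; rewrite subr_eq0; apply/eqP.
    by apply: (mulIf (lt0r_neq0 d0)); rewrite e1 mulVf// gt_eqF.
  move/eqP; rewrite mulf_eq0 subr_eq0 addr_eq0 => /orP[]/eqP ->; [by left|right].
  by rewrite scaleNr.
case: mult => a [] /norm [] ->; [left; left|left; right|right; left|right; right] => //.
Qed.

End Ridge.

(** * Rotations, tilts and the classification *)

Section Congruence.
Context {R : realType}.
Implicit Types f g h : R * R -> R.

Definition congruent f g : Prop := exists b A A', moves f g b A A'.

Lemma congruent_sym f g : congruent f g -> congruent g f.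
Proof. by move=> [b [A [A' m]]]; exists (- A' b), A', A; exact: moves_inv. Qed.

Lemma congruent_trans f g h : congruent f g -> congruent g h -> congruent f h.
Proof.
move=> [b [A [A' m]]] [b2 [A2 [A2' m2]]].
by exists (b2 + A2 b), (A2 \o A), (A' \o A2'); exact: moves_comp m m2.
Qed.

Lemma congruent_ext f g h : g =1 h -> congruent f g -> congruent f h.
Proof. by move=> /funext ->. Qed.

Lemma vertically_rigid_congruent (C : set R) f :
  vertically_rigid C f <-> forall c, C c -> congruent f (fun p => c * f p).
Proof.
split=> h c Cc; have := h c Cc.
  by move=> [phi [iphi im]]; exact: isometry3_moves iphi im.
by move=> [b [A [A' m]]]; exact: moves_isometry3 m.
Qed.

Lemma congruent_translation f u v : congruent f (fun p => f (p + u) + v).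
Proof.
exists (- u, v), id, id; split => // q.
rewrite /= (addrC (- u)) subrK [v + _]addrC; split=> [->//|].
exact: addIr.
Qed.

Lemma congruent_rotation f t : congruent (f \o rotation t) f.
Proof.
have cs := cos2Dsin2 t.
exists 0, (fun q => (rotation t q.1, q.2)), (fun q => (rotation (- t) q.1, q.2)).
have oA s : orth (fun q : R * R * R => (rotation s q.1, q.2)).
  split=> [a u v|u v]; first by apply: v3_eq; rewrite /= !scaleRE; ring.
  have css := cos2Dsin2 s; rewrite /dot /=.
  transitivity ((cos s ^+ 2 + sin s ^+ 2) * (u.1.1 * v.1.1 + u.1.2 * v.1.2) + u.2 * v.2).
    by ring.
  by rewrite css mul1r.
have canc s : cancel (fun q : R * R * R => (rotation s q.1, q.2)) (fun q => (rotation (- s) q.1, q.2)).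
  move=> [[x y] z]; rewrite /rotation cosN sinN /=; congr (_, _, _).
    transitivity ((cos s ^+ 2 + sin s ^+ 2) * x); first by ring.
    by rewrite cos2Dsin2 mul1r.
  transitivity ((cos s ^+ 2 + sin s ^+ 2) * y); first by ring.
  by rewrite cos2Dsin2 mul1r.
split => //; first by move=> q; have := canc (- t) q; rewrite opprK.
by move=> q; rewrite !add0r.
Qed.

Lemma congruent_rotation_scale f t c :
  congruent (f \o rotation t) (fun p => c * (f \o rotation t) p) <->
  congruent f (fun p => c * f p).
Proof.
have h1 := congruent_rotation f t; have h2 := congruent_rotation (fun p => c * f p) t.
split=> h.
  exact: congruent_trans (congruent_sym h1) (congruent_trans h h2).
exact: congruent_trans h1 (congruent_trans h (congruent_sym h2)).
Qed.

(** The rulings have direction [(0, 1, d)]; the rotation [T d] about the x-axis makes them parallel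
    to the y-axis. *)
Lemma congruent_tilt (g : R -> R) d :
  congruent (fun p => g p.1 + d * p.2) (fun p => g p.1 / Num.sqrt (1 + d ^+ 2)).
Proof.
have r2 : Num.sqrt (1 + d ^+ 2) ^+ 2 = 1 + d ^+ 2 by rewrite sqr_sqrtr// addr_ge0// sqr_ge0.
have r0 : Num.sqrt (1 + d ^+ 2) != 0 by rewrite sqrtr_eq0 -ltNge ltr_wpDr// sqr_ge0.
set r := Num.sqrt _ in r2 r0 *.
pose T (e : R) (q : R * R * R) : R * R * R :=
  (q.1.1, (q.1.2 + e * q.2) / r, (q.2 - e * q.1.2) / r).
have oT e : e ^+ 2 = d ^+ 2 -> orth (T e).
  move=> ed; split=> [a u v|u v].
    by apply: v3_eq; rewrite /= !scaleRE; field.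
  rewrite /dot /=; transitivity (u.1.1 * v.1.1 + (1 + e ^+ 2) / r ^+ 2 * (u.1.2 * v.1.2 + u.2 * v.2)).
    by field.
  by rewrite r2 ed divff ?mul1r ?addrA// -r2 expf_neq0.
have canc e : e ^+ 2 = d ^+ 2 -> cancel (T e) (T (- e)).
  move=> ed [[x y] z]; rewrite /T /=; congr (_, _, _).
    transitivity ((1 + e ^+ 2) / r ^+ 2 * y); first by field.
    by rewrite r2 ed divff ?mul1r// -r2 expf_neq0.
  transitivity ((1 + e ^+ 2) / r ^+ 2 * z); first by field.
  by rewrite r2 ed divff ?mul1r// -r2 expf_neq0.
exists 0, (T d), (T (- d)); split; [exact: oT|exact/oT/sqrrN|exact: canc| |].
  by move=> q; have := canc (- d) (sqrrN d) q; rewrite opprK.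
move=> q; rewrite add0r /=; split=> [->|]; first by rewrite addrK.
by move=> /(mulIf (invr_neq0 r0)) <-; rewrite subrK.
Qed.

Lemma unit_cos_sin (a b : R) : a ^+ 2 + b ^+ 2 = 1 -> exists t, cos t = a /\ sin t = b.
Proof.
move=> ab; have a1 : -1 <= a <= 1.
  by have := sqr_ge0 b; move=> b2; apply/andP; split; nra.
have sb : 1 - a ^+ 2 = b ^+ 2 by lra.
have [b0|b0] := leP 0 b.
  exists (acos a); rewrite acosK ?in_itv//=; split => //.
  by rewrite sin_acos// sb sqrtr_sqr ger0_norm.
exists (- acos a); rewrite cosN sinN acosK ?in_itv//=; split => //.
by rewrite sin_acos// sb sqrtr_sqr ltr0_norm// opprK.
Qed.

Lemma expR_shift (k x m : R) : k != 0 -> 0 < m ->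
  expR (k * (x + ln m / k)) = m * expR (k * x).
Proof.
move=> k0 m0; have -> : k * (x + ln m / k) = ln m + k * x by field.
by rewrite expRD lnK.
Qed.

(** Tilting both surfaces makes their rulings level. The profiles then differ by an additive
    constant and a factor [m] on the exponential, which a shift in x absorbs. *)
Lemma congruent_exp_plus_linear f c : 0 < c -> form_exp_plus_linear f ->
  congruent f (fun p => c * f p).
Proof.
move=> c0 [a [b [d [k [k0 hf]]]]].
pose r (e : R) := Num.sqrt (1 + e ^+ 2).
have r0 e : 0 < r e by rewrite sqrtr_gt0 ltr_wpDr// sqr_ge0.
pose g x := a + b * expR (k * x).
have h1 : congruent f (fun p => g p.1 / r d).
  have -> : f = (fun p => g p.1 + d * p.2) by apply/funext => -[x y]; rewrite hf.
  exact: congruent_tilt.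
have h2 : congruent (fun p => c * f p) (fun p => c * g p.1 / r (c * d)).
  have -> : (fun p => c * f p) = (fun p => c * g p.1 + (c * d) * p.2).
    by apply/funext => -[x y]; rewrite hf /g /=; ring.
  exact: (congruent_tilt (fun x => c * g x)).
apply: congruent_trans h1 (congruent_trans _ (congruent_sym h2)).
pose m := c * r d / r (c * d).
have m0 : 0 < m by rewrite divr_gt0// mulr_gt0.
apply: congruent_ext (congruent_translation _ (ln m / k, 0) (c * a / r (c * d) - a / r d)).
by move=> [x y]; rewrite /g /= expR_shift// /m; field; rewrite !gt_eqF.
Qed.

Lemma congruent_product_exp f c : 0 < c -> form_product_exp f ->
  congruent f (fun p => c * f p).
Proof.
move=> c0 [a [k [s [k0 [_ hf]]]]].
apply: congruent_ext (congruent_translation f (ln c / k, 0) (c * a - a)).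
move=> [x y]; rewrite [(x, y) + _]surjective_pairing !hf /= addr0.
by rewrite expR_shift//; ring.
Qed.

(* Rotating the gradient onto the y-axis reduces form (i) to form (iii) with
   [b = 0]. *)
Lemma affine_rotation f : form_affine f -> exists t, form_exp_plus_linear (f \o rotation t).
Proof.
move=> [a [b [d hf]]].
have [t bt] : exists t, b * cos t + d * sin t = 0.
  have [b0|b0] := eqVneq (b ^+ 2 + d ^+ 2) 0.
    move/eqP: b0; rewrite paddr_eq0 ?sqr_ge0// !sqrf_eq0 => /andP[/eqP -> /eqP ->].
    by exists 0; rewrite !mul0r addr0.
  have N2 : Num.sqrt (b ^+ 2 + d ^+ 2) ^+ 2 = b ^+ 2 + d ^+ 2.
    by rewrite sqr_sqrtr// addr_ge0 ?sqr_ge0.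
  have N0 : Num.sqrt (b ^+ 2 + d ^+ 2) != 0 by rewrite -sqrf_eq0 N2.
  set N := Num.sqrt _ in N2 N0.
  have [|t [ct st]] := @unit_cos_sin (d / N) (- b / N).
    by rewrite !exprMn -mulrDl sqrrN addrC -N2 exprVn mulfV// expf_neq0.
  by exists t; rewrite ct st; ring.
exists t, a, 0, (d * cos t - b * sin t), 1; split; first exact: oner_neq0.
move=> x y; rewrite /= hf /=;
  transitivity (a + (b * cos t + d * sin t) * x + (d * cos t - b * sin t) * y).
  by ring.
by rewrite bt; ring.
Qed.

Lemma continuous_rotation (t : R) : continuous (rotation t).
Proof.
apply: (@continuous_pair (R * R)%type R R) => p.
  by apply: cvgB; (apply: cvgM; [exact: cvg_cst|]); [exact: cvg_fst|exact: cvg_snd].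
by apply: cvgD; (apply: cvgM; [exact: cvg_cst|]); [exact: cvg_fst|exact: cvg_snd].
Qed.

Lemma exp_along_form f : continuous f -> exp_along f ->
  exists t, form_product_exp (f \o rotation t).
Proof.
move=> cf [w [a [k [w1 k0 hf]]]].
have [t [ct st]] := unit_cos_sin w1.
exists t, a, k, (fun y => f (rotation t (0, y)) - a); split => //; split.
  move=> y; apply: cvgB; last exact: cvg_cst.
  apply: (@continuous_comp R (R * R)%type R (fun y => rotation t (0, y)) f); last exact: cf.
  apply: (@continuous_comp R (R * R)%type (R * R)%type (pair 0) (rotation t)).
    by apply: (@continuous_pair R R R); [exact: cst_continuous|move=> ?; exact: cvg_id].
  exact: continuous_rotation.
move=> x y; have := hf (rotation t (0, y)) x.
have -> : rotation t (0, y) + x *: w = rotation t (x, y).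
  by apply: pair_eq; rewrite /= !scaleRE ct st; ring.
by rewrite /=; lra.
Qed.

Lemma ridge_form f d (C : set R) : continuous f ->
  ~ countable C -> (forall c, C c -> 0 < c) ->
  (forall c, C c -> congruent f (fun p => c * f p)) ->
  (forall x y, f (x, y) = f (x, 0) + d * y) ->
  form_affine f \/ form_exp_plus_linear f.
Proof.
move=> cf nC C0 Cf fd.
have [[a [b aff]]|naff] := pselect (exists a b, forall x, f (x, 0) = a + b * x).
  by left; exists a, b, d => x y; rewrite fd aff.
right; pose r (e : R) := Num.sqrt (1 + e ^+ 2).
have r0 e : 0 < r e by rewrite sqrtr_gt0 ltr_wpDr// sqr_ge0.
have r2 e : r e ^+ 2 = 1 + e ^+ 2 by rewrite sqr_sqrtr// addr_ge0// sqr_ge0.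
have rn e : r e != 0 by rewrite gt_eqF.
pose g x := f (x, 0).
pose h (p : R * R) := g p.1 / r d.
have ch : continuous h.
  move=> p; apply: cvgM; last exact: cvg_cst.
  apply: (@continuous_comp (R * R)%type (R * R)%type R (fun p => (p.1, 0)) f); last exact: cf.
  by apply: (@continuous_pair (R * R)%type R R fst); [move=> ?;
    exact: cvg_fst|exact: cst_continuous].
(* The factor relating the tilted surface of [c * f] to that of [f]; it is injective on [C], so its
   values are still uncountably many. *)
pose mu c := c * r d / r (c * d).
have mu0 c : C c -> 0 < mu c by move=> /C0 c0; rewrite divr_gt0// mulr_gt0.
have mu_inj : forall c e, C c -> C e -> mu c = mu e -> c = e.
  move=> c e /C0 c0 /C0 e0 /(congr1 (fun x => x ^+ 2)).
  rewrite /mu !exprMn !exprVn !r2 => E; apply/eqP; rewrite -(eqrXn2 (n := 2)) ?ltW//;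
    apply/eqP.
  have p1 : 1 + (c * d) ^+ 2 != 0 by rewrite -r2 expf_neq0.
  have p2 : 1 + (e * d) ^+ 2 != 0 by rewrite -r2 expf_neq0.
  have p3 : 1 + d ^+ 2 != 0 by rewrite -r2 expf_neq0.
  apply: (mulIf p3); move/eqP: E; rewrite eqr_div// => /eqP E.
  lra.
have hmov m : (mu @` C) m -> exists b A A', moves h (fun p => m * h p) b A A'.
  move=> [c Cc <-].
  have h1 : congruent f h.
    have -> : f = (fun p => g p.1 + d * p.2) by apply/funext => -[x y]; rewrite fd.
    exact: congruent_tilt.
  have h2 : congruent (fun p => c * f p) (fun p => mu c * h p).
    apply: (@congruent_ext _ (fun p => c * g p.1 / r (c * d))).
      by move=> p; rewrite /mu /h; field; rewrite !rn.
    have -> : (fun p => c * f p) = (fun p => c * g p.1 + (c * d) * p.2).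
      by apply/funext => -[x y]; rewrite fd /g /=; ring.
    exact: (congruent_tilt (fun x => c * g x)).
  exact: congruent_trans (congruent_sym h1) (congruent_trans (Cf c Cc) h2).
have naffh : ~ exists a b, forall x, h (x, 0) = a + b * x.
  apply: contra_not naff => -[a [b hab]]; exists (r d * a), (r d * b) => x.
  have := hab x; rewrite /h /= -/(g x) => /(canRL (divfK (rn d))) ->; ring.
have [|w [a [k [w1 k0 hw]]]] := exp_along_ridge ch (fun _ _ => erefl) naffh _ hmov
  (uncountable_image nC mu_inj).
  by move=> _ [c Cc <-]; exact: mu0.
(* Along the y-axis [h] is constant, so an exponential law in that direction would force [h] to
   equal [a] everywhere. *)
have w10 : w.1 != 0.
  apply: contra_notN naffh => /eqP w0; exists a, 0 => x.
  have := hw (x, 0) 1; rewrite {1}/h /= w0 scaler0 addr0 -/(h (x, 0)) => e.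
  have : (1 - expR (k * 1)) * (h (x, 0) - a) = 0 by rewrite mulrBl mul1r -e subrr.
  move/eqP; rewrite mulf_eq0 mulr1 subr_eq0 eq_sym => /orP[/eqP ek|/eqP]; last by lra.
  by move/eqP: k0; case; apply: expR_inj; rewrite ek expR0.
exists (r d * a), (r d * (h (0, 0) - a)), d, (k / w.1); split.
  by rewrite mulf_neq0// invr_eq0.
move=> x y; rewrite fd -/(g x); congr (_ + _).
have := hw (0, 0) (x / w.1); rewrite {1}/h /= add0r scaleRE divfK// => e.
have -> : g x = r d * (g x / r d) by field.
have -> : g x / r d = a + expR (k * (x / w.1)) * (h (0, 0) - a) by move: e; lra.
by have -> : k * (x / w.1) = k / w.1 * x; ring.
Qed.

Lemma rigid_form f (C : set R) : continuous f -> condensates_to_infty C ->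
  (forall c, C c -> congruent f (fun p => c * f p)) ->
  exists t, form_affine (f \o rotation t) \/ form_product_exp (f \o rotation t) \/
    form_exp_plus_linear (f \o rotation t).
Proof.
move=> cf [C0 Cunc] Cf.
have nC : ~ countable C.
  apply: contra_not (Cunc 0) => h; apply: sub_countable h; apply: subset_card_le.
  by move=> c [].
have Cinf r : exists2 c, C c & r < c.
  have [c [Cc rc]] : C `&` [set c | r < c] !=set0.
    by apply/set0P/eqP => e; apply: (Cunc r); rewrite e; exact: countable0.
  by exists c.
have [ptd|] := pselect (forall w, slope_cone f w -> slope_cone f (- w) -> w = 0).
  have [t ht] := exp_along_form cf (exp_along_pointed cf C0 Cf Cinf ptd nC).
  by exists t; right; left.
move=> /existsNP[w /not_implyP[hw /not_implyP[hNw /eqP w0]]].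
have L := slope_cone_lineality hw hNw.
have w10 : w.1 != 0.
  apply: contra_neq w0 => w10; apply: pair_eq => //=.
  by have := L 1 0; rewrite w10 scaler0 addr0; lra.
pose n := Num.sqrt (w.1.1 ^+ 2 + w.1.2 ^+ 2).
have n2 : n ^+ 2 = w.1.1 ^+ 2 + w.1.2 ^+ 2 by rewrite sqr_sqrtr// addr_ge0 ?sqr_ge0.
have n0 : n != 0.
  rewrite -sqrf_eq0 n2 paddr_eq0 ?sqr_ge0// !sqrf_eq0.
  by apply: contra w10 => /andP[/eqP e1 /eqP e2]; exact/eqP/pair_eq.
(* The rotation takes the y-axis to the direction [w.1], along which [f] is affine with slope
   [w.2 / n]. *)
have [|t [ct st]] := @unit_cos_sin (w.1.2 / n) (- w.1.1 / n).
  by rewrite !exprMn -mulrDl sqrrN addrC -n2 exprVn mulfV// expf_neq0.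
exists t.
have cft : continuous (f \o rotation t).
  move=> p; apply: (@continuous_comp (R * R)%type (R * R)%type R (rotation t) f);
    last exact: cf.
  exact: continuous_rotation.
have [||h|h] := @ridge_form (f \o rotation t) (w.2 / n) C cft nC C0.
- by move=> c Cc; apply/congruent_rotation_scale; exact: Cf.
- move=> x y; have := L (y / n) (rotation t (x, 0)).
  have -> : rotation t (x, 0) + (y / n) *: w.1 = rotation t (x, y).
    by apply: pair_eq; rewrite /= !scaleRE ct st; field.
  by move=> /= ->; ring.
- by left.
- by right; right.
Qed.

End Congruence.

Theorem theorem1p8 (R : realType) (C : set R) (f : R * R -> R)
    (hC : condensates_to_infty C) (hf : continuous f) :
  vertically_rigid C f <->
  exists t : R,
    form_affine (f \o rotation t) \/
    form_product_exp (f \o rotation t) \/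
    form_exp_plus_linear (f \o rotation t).
Proof.
rewrite vertically_rigid_congruent; split=> [|[t ht] c Cc]; first exact: rigid_form.
have c0 : 0 < c by exact: hC.1.
apply/(congruent_rotation_scale f t).
case: ht => [/affine_rotation[t' ht']|[ht|ht]].
- apply/(congruent_rotation_scale _ t'); exact: congruent_exp_plus_linear.
- exact: congruent_product_exp.
- exact: congruent_exp_plus_linear.
Qed.
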